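(* Consider the network model, interest-based mobility model and FirstMeeting (FM) routing described in the context, but with the destination's profile random: the angle $\angle(S,D)$ is chosen uniformly at random in $[0,\pi/2]$. Let $T^{ib}_{FM}$ be the time at which the message is first delivered to $D$. Then $\mathbb{E}[T^{ib}_{FM}]=O(1)$ as $n\to\infty$.
   Context: Network: fix an integer $m\ge 2$ independent of $n$. There are $n+2$ nodes: a source $S$, a destination $D$ and relays $R_1,\dots,R_n$. Each node $X$ has an interest profile, a unit vector in the closed positive orthant of the unit sphere of $\mathbb{R}^m$; $\cos\angle(X,Y)=\langle X,Y\rangle$. $S=(1,0,\dots,0)$. The relay profiles (and here also $D$'s profile) are independent: the angle with $S$ is uniform on $[0,\pi/2]$, and given this angle the profile is uniform among unit vectors of the positive orthant making that angle with $S$. Profiles are fixed in time. Conditional on the profiles, for each unordered pair $\{A,B\}$ the meeting instants form a Poisson process of rate $\lambda_{AB}$, independently over pairs, from time $0$. Interest-based mobility: $\lambda_{AB}=k\cos\angle(A,B)+\delta$, with $\lambda>0$ fixed, $\delta=\delta(n)>0$, $\delta(n)\to0$, $k=\frac{\pi}{2}(\lambda-\delta)$. FM routing: $S$ holds two copies and always keeps one. If the first node met by $S$ among $\{D,R_1,\dots,R_n\}$ is $D$, the message is delivered then; otherwise the second copy is given to that first relay $R_j$, no further copies are created or transferred, and the message is delivered when the first of $S,R_j$ meets $D$. Expectations are over all profiles and meeting processes. *)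

(* Defs.v *)
From HB Require Import structures.
From mathcomp Require Import all_boot all_order all_algebra.
From mathcomp Require Import all_classical all_reals all_analysis.
Set Implicit Arguments. Unset Strict Implicit. Unset Printing Implicit Defensive.
Import Order.TTheory GRing.Theory Num.Def Num.Theory.
Local Open Scope classical_set_scope.
Local Open Scope ring_scope.

Section FM.
Variable R : realType.

(* A profile in R^m is represented by x : nat -> R; only coordinates 0..m-1
   are meaningful. *)
Definition dotm (m : nat) (x y : nat -> R) : R := \sum_(i < m) x i * y i.

Definition normk (k : nat) (x : nat -> R) : R := Num.sqrt (\sum_(i < k) x i ^+ 2).

Definition in_orthant_sphere (m : nat) (x : nat -> R) : Prop :=
  (forall i, (i < m)%N -> 0 <= x i) /\ dotm m x x = 1.

Definition e1 : nat -> R := fun i => if i == 0%N then 1 else 0.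

(* angle with S (= e1) of a profile x, and its normalized "direction"
   (x_1,...,x_{m-1}) / sin(angle), a point of the positive orthant of the
   unit sphere of R^(m-1) *)
Definition angleS (x : nat -> R) : R := acos (x 0%N).
Definition dirS (x : nat -> R) : nat -> R :=
  fun i => x i.+1 / Num.sqrt (1 - x 0%N ^+ 2).

Definition upd (x : nat -> R) (j : nat) (t : R) : nat -> R :=
  fun i => if i == j then t else x i.

Fixpoint iint (k : nat) (f : (nat -> R) -> \bar R) : (nat -> R) -> \bar R :=
  match k with
  | 0 => f
  | k'.+1 => fun x => (\int[lebesgue_measure]_t iint k' f (upd x k' t))%E
  end.

Definition volk (k : nat) (C : set (nat -> R)) : \bar R :=
  iint k (fun x => (\1_C x)%:E) (fun _ => 0).

(* cone over the set of points u of the positive orthant of the unit sphere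
   of R^k with u_i <= a_i for all i < k *)
Definition cone_le (k : nat) (a : nat -> R) : set (nat -> R) :=
  [set x | (forall i, (i < k)%N -> 0 <= x i) /\ 0 < normk k x <= 1 /\
           (forall i, (i < k)%N -> x i / normk k x <= a i)].

(* distribution function of the uniform (normalized surface) measure on the
   positive orthant of the unit sphere of R^k, defined through the cone
   measure: sigma(A) = vol(cone A) / vol(cone of the whole orthant sphere) *)
Definition sph_cdf (k : nat) (a : nat -> R) : R :=
  fine (volk k (cone_le k a)) / fine (volk k (cone_le k (fun _ => 1))).

Definition unif_cdf (b : R) : R := Num.min 1 (Num.max 0 (b / (pi / 2))).

(* nodes : 'I_n.+2 ; 0 = S, 1 = D, j.+2 = relay R_{j+1} *)
Definition nS {n : nat} : 'I_n.+2 := ord0.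
Definition nD {n : nat} : 'I_n.+2 := inord 1.
Definition is_relay {n : nat} (v : 'I_n.+2) : bool := (2 <= v)%N.

Definition rate_ib (m : nat) (lam delta : R) (x y : nat -> R) : R :=
  (pi / 2 * (lam - delta)) * dotm m x y + delta.

(* G a b l (for a < b) is the l-th inter-meeting gap of the pair {a,b}:
   the meeting instants of {a,b} are the partial sums G a b 0 + ... + G a b i *)
Definition gap {n : nat} (G : 'I_n.+2 -> 'I_n.+2 -> nat -> R)
  (a b : 'I_n.+2) (l : nat) : R := if (a < b)%N then G a b l else G b a l.

Definition arrival {n : nat} (G : 'I_n.+2 -> 'I_n.+2 -> nat -> R)
  (a b : 'I_n.+2) (i : nat) : R := \sum_(l < i.+1) gap G a b l.

(* first meeting instant of {a,b} strictly after time t (+oo if none) *)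
Definition first_after {n : nat} (G : 'I_n.+2 -> 'I_n.+2 -> nat -> R)
  (a b : 'I_n.+2) (t : R) : \bar R :=
  ereal_inf [set (arrival G a b i)%:E | i in [set i | t < arrival G a b i]].

(* delivery time of FirstMeeting routing.  tau = first meeting of S with a
   node of {D, R_1, ..., R_n}.  If D is met first, delivery at tau; otherwise
   the copy goes to the relay R_j met at tau and the message is delivered at
   the first meeting of S or R_j with D after tau.  (Ties, which have
   probability 0, are resolved in favour of D, then of the smallest relay.) *)
Definition delivery_FM {n : nat} (G : 'I_n.+2 -> 'I_n.+2 -> nat -> R)
  : \bar R :=
  let tau := \big[Num.min/arrival G nS nD 0]_(v < n.+2 | is_relay v)
               arrival G nS v 0 in
  if arrival G nS nD 0 <= tau then (arrival G nS nD 0)%:E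
  else match [pick v : 'I_n.+2 | is_relay v && (arrival G nS v 0 == tau)] with
       | Some j => Order.min (first_after G nS nD tau) (first_after G j nD tau)
       | None => (arrival G nS nD 0)%:E
       end.

(* X v w : profile of node v; G a b l w : gaps of the meeting process of {a,b} *)
Definition FM_ib_model (m : nat) (lam delta : R) (n : nat)
  {d : measure_display} (T : measurableType d) (P : probability T R)
  (X : 'I_n.+2 -> T -> nat -> R)
  (G : 'I_n.+2 -> 'I_n.+2 -> nat -> T -> R) : Prop :=
  (forall v i, measurable_fun setT (fun w => X v w i)) /\
  (forall a b l, measurable_fun setT (G a b l)) /\
  (forall w, X nS w = e1) /\
  (forall v w, in_orthant_sphere m (X v w)) /\
  (* the profiles of D and of the relays are independent; for each of them
     the angle with S is uniform on [0, pi/2] and, given this angle, the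
     profile is uniform among the unit vectors of the positive orthant making
     that angle with S (i.e. its direction is uniform on the positive orthant
     of the unit sphere of R^(m-1), independently of the angle): the joint
     distribution function factorizes *)
  (forall (b : 'I_n.+2 -> R) (a : 'I_n.+2 -> nat -> R),
     P (\bigcap_(v in [set v : 'I_n.+2 | v != nS])
          [set w | angleS (X v w) <= b v /\
                   forall i, (i < m.-1)%N -> dirS (X v w) i <= a v i])
     = (\prod_(v < n.+2 | v != nS) (unif_cdf (b v) * sph_cdf m.-1 (a v)))%:E)
  /\
  (* conditionally on the profiles, the meeting processes of the pairs are
     independent Poisson processes of rates rate_ib: all gaps are
     conditionally independent exponential variables with these rates *)
  (forall (E : set T)
          (L : seq ('I_n.+2 * 'I_n.+2 * nat)) (s : 'I_n.+2 * 'I_n.+2 * nat -> R),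
     <<s [set A | exists v i (B : set R), measurable B /\
                  A = (fun w => X v w i) @^-1` B] >> E ->
     uniq L -> all (fun q : 'I_n.+2 * 'I_n.+2 * nat => (q.1.1 < q.1.2)%N) L ->
     (forall q, q \in L -> 0 <= s q) ->
     P (E `&` \bigcap_(q in [set` L]) [set w | s q < G q.1.1 q.1.2 q.2 w])
     = (\int[P]_(w in E)
          (\prod_(q <- L)
             expR (- rate_ib m lam delta (X q.1.1 w) (X q.1.2 w) * s q))%:E)%E).

End FM.

(* Main.v *)
Require Import Defs.
From HB Require Import structures.
From mathcomp Require Import all_boot all_order all_algebra.
From mathcomp Require Import all_classical all_reals all_analysis.
From mathcomp Require Import measurable_realfun lebesgue_measure.
From mathcomp Require Import ring lra zify.
Import Order.TTheory GRing.Theory Num.Def Num.Theory.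
Import numFieldTopology.Exports.
Local Open Scope classical_set_scope.
Local Open Scope ring_scope.
Set Implicit Arguments. Unset Strict Implicit. Unset Printing Implicit Defensive.

(** Let tau be the first meeting instant of S, let R_j be the relay met at tau,
    and round tau up to a multiple a of h = 1/n.  If no gap of {R_j, D} is
    <= 0 and R_j does not meet D during (a, 2a + t], then some gap of {R_j, D}
    exceeds a + t while all the previous ones are <= a.  Given the profiles, and
    with r the rate of {R_j, D}, this has probability at most
    sum_i (1 - e^(-ra))^i e^(-r(a+t)) = e^(-rt).  Hence the delivery time is at
    most 2(tau + h) plus an excess with tail e^(-mu_j t), where mu_j is the sum
    of the rates of {S, D} and {R_j, D}, and only events that are boxes in the
    gaps are ever needed.  Summing over the cells of the grid,
    E[T] <= 2h + 2 E[tau] + sum_j C E[(1 + 1/mu_j) / Lambda_j], where Lambda_j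
    is the sum of the rates of S with the relays other than R_j.  The
    harmonic-arithmetic mean inequality over pairs {a, b} of such relays reduces
    1/Lambda_j to averages of 1/(lambda_Sa + lambda_Sb), which are O(1/n) in
    expectation: cos a + cos b has an integrable inverse although cos a does
    not.  Likewise, with u the coordinate 1 of the profiles, mu_j is at least a
    multiple of cos D + u_D u_j >= 2 sqrt(cos D * u_D * u_j), and the inverse
    square root on the right is integrable, uniformly in delta. *)

(** * Integrals and elementary inequalities *)

(** The integral of a nonnegative function is a supremum over the simple functions below it, hence
    monotone without measurability, and the integral of [f] is at most that of its positive part.
    The delivery time and the iterated integrals [iint], not known to be measurable, are bounded in
    this way. *)
Lemma le_integral_nonmeasurable (R : realType) (d : measure_display)
    (T : measurableType d) (mu : {measure set T -> \bar R}) (f g : T -> \bar R) :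
  (forall x, 0 <= g x)%E -> (forall x, f x <= g x)%E ->
  (\int[mu]_x f x <= \int[mu]_x g x)%E.
Proof.
move=> g0 fg; rewrite integralE.
have fp0 x : (0 <= (f ^\+)%E x)%E by exact: funepos_ge0.
apply: (@le_trans _ _ (\int[mu]_x (f ^\+)%E x)%E).
  rewrite -[leRHS]sube0; apply: leeB => //.
  by apply: integral_ge0 => x _; exact: funeneg_ge0.
rewrite !ge0_integralTE//; apply: le_ereal_sup => _ [h /= hf <-].
exists h => // x; apply: le_trans (hf x) _.
by rewrite funeposE ge_max fg g0.
Qed.

(** Monotone convergence, where [F] is a closed form that only has to dominate the partial sums. All
    series of box probabilities are summed with it. *)
Lemma nneseries_integral_le (R : realType) (d : measure_display)
    (T : measurableType d) (mu : {measure set T -> \bar R})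
    (f : nat -> T -> R) (F : T -> R) :
  (forall k, measurable_fun setT (f k)) -> (forall k x, 0 <= f k x) ->
  (forall N x, \sum_(k < N) f k x <= F x) ->
  (\sum_(k <oo) \int[mu]_x (f k x)%:E <= \int[mu]_x (F x)%:E)%E.
Proof.
move=> mf f0 fF; rewrite -integral_nneseries//; last 2 first.
- by move=> n; exact/measurable_EFinP.
- by move=> n x _; rewrite lee_fin.
have F0 x : 0 <= F x by apply: le_trans (fF 0%N x); rewrite big_ord0.
apply: le_integral_nonmeasurable => x; first by rewrite lee_fin.
apply: lime_le; first by apply: is_cvg_nneseries => n _ _; rewrite lee_fin.
by apply: nearW => n; rewrite big_mkord sumEFin lee_fin.
Qed.

(** Follows from [1 + x <= expR x]. It turns geometric sums over a time grid into inverse rates, the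
    term 1 being the price of the discretization. *)
Lemma inv_onem_expR_le (R : realType) (x : R) : 0 < x ->
  (1 - expR (- x))^-1 <= 1 + x^-1.
Proof.
move=> x0; have h : 1 + x <= expR x by exact: expR_ge1Dx.
have e1 : expR (- x) <= (1 + x)^-1.
  by rewrite expRN lef_pV2 ?posrE ?expR_gt0//; lra.
have h2 : x / (1 + x) <= 1 - expR (- x).
  suff -> : x / (1 + x) = 1 - (1 + x)^-1 by lra.
  by field; lra.
have p : 0 < x / (1 + x) by apply: divr_gt0; lra.
have -> : 1 + x^-1 = (x / (1 + x))^-1 by field; apply/andP; split; lra.
by rewrite lef_pV2 ?posrE//; lra.
Qed.

Lemma onem_expR_le (R : realType) (x : R) : 1 - expR (- x) <= x.
Proof. have := expR_ge1Dx (- x); lra. Qed.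

Lemma onem_expR_ge0 (R : realType) (x : R) : 0 <= x -> 0 <= 1 - expR (- x).
Proof. by move=> x0; rewrite subr_ge0 -expR0 ler_expR; lra. Qed.

Lemma sum_geometric_le (R : realType) (x : R) (N : nat) : 0 <= x < 1 ->
  \sum_(i < N) x ^+ i <= (1 - x)^-1.
Proof.
move=> /andP[x0 x1].
have h : (1 - x) * (\sum_(i < N) x ^+ i) = 1 - x ^+ N by have := subrX1 x N; lra.
have p : 0 < 1 - x by lra.
rewrite -(ler_pM2l p) h mulfV ?gt_eqF//.
by have := exprn_ge0 N x0; lra.
Qed.

(** The tangent-line bound of [x^-1] at the arithmetic mean [y] is summed over the indices. *)
Lemma harmonic_mean_le (R : realType) (I : finType) (Q : pred I) (x : I -> R) :
  (forall i, Q i -> 0 < x i) ->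
  #|Q|%:R ^+ 2 <= (\sum_(i | Q i) x i) * (\sum_(i | Q i) (x i)^-1).
Proof.
move=> x0; have [/eqP/card0_eq Q0|Qn0] := boolP (#|Q| == 0%N).
  rewrite !big_pred0 ?mul0r// ?eq_card0 ?expr0n// => i; by have := Q0 i.
set S := \sum_(i | Q i) x i.
have S0 : 0 < S.
  move: Qn0; rewrite -lt0n => /card_gt0P[i Qi].
  rewrite /S (bigD1 i)//= ltr_wpDr ?x0//.
  by apply: sumr_ge0 => j /andP[Qj _]; exact/ltW/x0.
set n := #|Q|%:R : R; have n0 : 0 < n by rewrite ltr0n lt0n.
set y := S / n; have y0 : 0 < y by exact: divr_gt0.
have h i : Q i -> 2 / y - x i / y ^+ 2 <= (x i)^-1.
  move=> Qi; have xi := x0 _ Qi; rewrite -subr_ge0.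
  have -> : (x i)^-1 - (2 / y - x i / y ^+ 2) = (y - x i) ^+ 2 / (x i * y ^+ 2).
    by field; rewrite !gt_eqF.
  by apply: divr_ge0; [exact: sqr_ge0|apply: mulr_ge0; [exact: ltW|exact: sqr_ge0]].
have : \sum_(i | Q i) (2 / y - x i / y ^+ 2) <= \sum_(i | Q i) (x i)^-1.
  exact: ler_sum.
rewrite sumrB -[X in _ - X]mulr_suml sumr_const -/S -[_ *+ _]mulr_natr -/n => h2.
apply: le_trans (ler_wpM2l (ltW S0) h2); rewrite le_eqVlt; apply/orP; left.
by apply/eqP; rewrite /y; field; rewrite !gt_eqF.
Qed.

Lemma cos1_mul_le_sin (R : realType) (y : R) : 0 <= y <= 1 -> cos 1 * y <= sin y.
Proof.
move=> /andP[y0 y1].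
have [c] := MVT_segment y0 (fun x _ => is_derive_sin x)
  (continuous_subspaceT (@continuous_sin R)).
rewrite in_itv/= => /andP[c0 cy]; rewrite sin0 !subr0 => ->.
apply: ler_wpM2r => //.
have [->//|c1] := eqVneq c 1.
have hc : c < 1 by rewrite lt_neqAle c1; lra.
apply/ltW; rewrite ltr_cos// in_itv/=; have := pi_ge2 R; lra.
Qed.

(** The scale [4^-k] goes with the weight [2^k], the value of [u ^ (-1/2)] at [u = 4^-k]. *)
Definition dyadic {R : realType} (k : nat) : R := 4^-1 ^+ k.

Lemma dyadic_gt0 (R : realType) k : 0 < dyadic k :> R.
Proof. by apply: exprn_gt0; lra. Qed.

Lemma dyadic_le1 (R : realType) k : dyadic k <= 1 :> R.
Proof. by apply: exprn_ile1; lra. Qed.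

Lemma exp4_dyadic (R : realType) k : (2 ^+ k) ^+ 2 * dyadic k = 1 :> R.
Proof.
rewrite /dyadic exprAC -exprMn; have -> : 2 ^+ 2 / 4 = 1 :> R by field.
exact: expr1n.
Qed.

(** [Q k] stands for being within [4^-k] of a singularity. If [Q] holds at [K - 1], that term alone
    gives [2^K]. Otherwise the least [k] at which [Q] fails is positive because of [Q 0], and the
    term of index [k - 1] gives [2^k]. *)
Lemma dyadic_sum_cases (R : realType) (K : nat) (Q : nat -> bool) (q : nat -> R) :
  Q 0%N -> (forall k, (Q k)%:R <= q k) -> (0 < K)%N ->
  let S := \sum_(k < K) 2 ^+ k.+1 * q k in
  2 ^+ K <= S \/ (exists2 k, ~~ Q k & 2 ^+ k <= S).
Proof.
move=> Q0 Qq K0 S.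
have q0 k : 0 <= q k by apply: le_trans (Qq k); rewrite ler0n.
have hS k : (k < K)%N -> Q k -> 2 ^+ k.+1 <= S.
  move=> kK Qk; rewrite /S (bigD1 (Ordinal kK))//=.
  apply: (@le_trans _ _ (2 ^+ k.+1 * q k)).
    rewrite -[leLHS]mulr1; apply: ler_wpM2l; first exact: exprn_ge0.
    by have := Qq k; rewrite Qk.
  by rewrite lerDl; apply: sumr_ge0 => i _; apply: mulr_ge0 => //; exact: exprn_ge0.
case: (boolP (Q K.-1)) => QK; first by left; rewrite -{1}(prednK K0); apply: hS => //; rewrite prednK.
right; have ex : exists k, ~~ Q k by exists K.-1.
case: (ex_minnP ex) => k nQk kmin; exists k => //.
have kK := kmin _ QK; case: k nQk kmin kK => [|k]; first by rewrite Q0.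
move=> nQk kmin kK; apply: hS; first by lia.
by apply/negPn/negP => /kmin; rewrite ltnn.
Qed.

(* [psi_len K u] and [psi_angle K a] are, up to constants, the truncations at
   [2 ^+ K] of [u ^ (-1/2)] and of [(cos a * sin a) ^ (-1/2)].  Being finite sums
   of indicators, they have expectations that are finite sums of values of the
   distribution function; the truncation is harmless because all rates are at
   least [delta > 0]. *)
Definition psi_len {R : realType} (K : nat) (u : R) : R :=
  \sum_(k < K) 2 ^+ k.+1 * (u <= dyadic k :> R)%R%:R.

Definition psi_angle {R : realType} (K : nat) (a : R) : R :=
  \sum_(k < K) 2 ^+ k.+1 *
    ((a <= dyadic k :> R)%R%:R + (pi / 2 - dyadic k < a :> R)%R%:R).

(** At the level [k] where the indicator vanishes, [u > 4^-k] while the sum is at least [2^k], and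
    [(2^k)^2 * 4^-k = 1]. *)
Lemma psi_len_cases (R : realType) (K : nat) (u : R) : (0 < K)%N -> u <= 1 ->
  1 <= psi_len K u /\ (2 ^+ K <= psi_len K u \/ 1 <= psi_len K u ^+ 2 * u).
Proof.
move=> K0 u1.
case: (@dyadic_sum_cases R K (fun k => (u <= dyadic k)%R)
  (fun k => (u <= dyadic k :> R)%R%:R) _ _ K0) => //.
- rewrite -/(psi_len K u) => h; split; last by left.
  by apply: le_trans h; apply: exprn_ege1; lra.
- move=> [k]; rewrite -/(psi_len K u) -ltNge => uk h.
  have h1 : 1 <= 2 ^+ k :> R by apply: exprn_ege1; lra.
  split; first exact: le_trans h.
  right; rewrite -(exp4_dyadic R k); apply: ler_pM.
  + exact: sqr_ge0.
  + exact/ltW/dyadic_gt0.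
  + by apply: lerXn2r => //; rewrite nnegrE; lra.
  + exact: ltW.
Qed.

(** At distance at least [4^-k] from both ends of [[0, pi/2]], sine and cosine are at least
    [cos 1 * 4^-k], and one of them is at least 1/2 because their squares add up to 1. This is the
    origin of the constant [cos 1 / 2]. *)
Lemma psi_angle_cases (R : realType) (K : nat) (a : R) : (0 < K)%N ->
  0 <= a <= pi / 2 ->
  1 <= psi_angle K a /\ (2 ^+ K <= psi_angle K a \/
    cos 1 / 2 <= psi_angle K a ^+ 2 * (cos a * sin a)).
Proof.
move=> K0 /andP[a0 ap].
have pl := pihalf_lt2 R; have pg := pihalf_ge1 R.
case: (@dyadic_sum_cases R K (fun k => (a <= dyadic k) || (pi / 2 - dyadic k < a))
  (fun k => (a <= dyadic k :> R)%R%:R + (pi / 2 - dyadic k < a :> R)%R%:R) _ _ K0) => //.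
(* At level 0 the two neighbourhoods have radius 1 and cover the whole interval, since
   [pi / 2 < 2]. *)
- by rewrite /dyadic expr0; case: (lerP a 1) => //= a1; lra.
- by move=> k; case: (a <= _); case: (_ < a) => /=; rewrite ?addr0 ?add0r//; lra.
- rewrite -/(psi_angle K a) => h; split; last by left.
  by apply: le_trans h; apply: exprn_ege1; lra.
- move=> [k]; rewrite -/(psi_angle K a) negb_or -ltNge -leNgt => /andP[ak1 ak2] h.
  have h1 : 1 <= 2 ^+ k :> R by apply: exprn_ege1; lra.
  split; first exact: le_trans h.
  right; have d0 := dyadic_gt0 R k; have d1 := dyadic_le1 R k.
  have c1 := cos1_gt0 R.
  have sk : cos 1 * dyadic k <= sin (dyadic k) :> R by apply: cos1_mul_le_sin; lra.
  have sin_mono (x : R) : dyadic k <= x <= pi / 2 -> cos 1 * dyadic k <= sin x.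
    move=> /andP[x1 x2]; apply: (le_trans sk); have [->//|xk] := eqVneq (dyadic k) x.
    by apply/ltW; rewrite ltr_sin ?in_itv/= ?lt_neqAle ?xk//; lra.
  have sa : cos 1 * dyadic k <= sin a by apply: sin_mono; lra.
  have ca : cos 1 * dyadic k <= cos a.
    have -> : cos a = sin (pi / 2 - a) by rewrite sinB cos_pihalf sin_pihalf; lra.
    by apply: sin_mono; lra.
  have cd : 0 < cos 1 * dyadic k :> R by exact: mulr_gt0.
  have cs : cos 1 * dyadic k / 2 <= cos a * sin a.
    case: (lerP (1/2) (cos a)) => hc.
      have : 1/2 * (cos 1 * dyadic k) <= cos a * sin a by apply: ler_pM => //; lra.
      by lra.
    have hs : 1 / 2 <= sin a.
      rewrite leNgt; apply/negP => hs.
      have := cos2Dsin2 a.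
      have : cos a ^+ 2 <= (1/2) ^+ 2 by apply: lerXn2r; rewrite ?nnegrE; lra.
      have : sin a ^+ 2 <= (1/2) ^+ 2 by apply: lerXn2r; rewrite ?nnegrE; lra.
      by lra.
    have : (cos 1 * dyadic k) * (1/2) <= cos a * sin a by apply: ler_pM => //; lra.
    by lra.
  have -> : cos 1 / 2 = (2 ^+ k) ^+ 2 * (cos 1 * dyadic k / 2) :> R.
    have -> : (2 ^+ k) ^+ 2 * (cos 1 * dyadic k / 2) =
      ((2 ^+ k) ^+ 2 * dyadic k) * (cos 1 / 2) :> R by ring.
    by rewrite exp4_dyadic mul1r.
  apply: ler_pM => //; first by lra.
  by apply: lerXn2r => //; rewrite nnegrE; lra.
Qed.

(** * Distribution of the profiles *)

Lemma iint_ge0 (R : realType) (k : nat) (f : (nat -> R) -> \bar R) :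
  (forall x, 0 <= f x)%E -> forall x, (0 <= iint k f x)%E.
Proof.
move=> f0; elim: k => [|k IH] x //=.
by apply: integral_ge0 => t _; exact: IH.
Qed.

Lemma integral_mul_itv (R : realType) (c e : R) : 0 <= c -> 0 <= e ->
  (\int[lebesgue_measure]_t (c * (0 <= t <= e)%R%:R)%:E = (c * e)%:E)%E.
Proof.
move=> c0 e0.
have -> : (fun t : R => (c * (0 <= t <= e)%R%:R)%:E) =
  (fun t => c%:E * (\1_(`[0, e]%classic : set R) t)%:E)%E.
  apply/funext => t; rewrite -EFinM indicE.
  by congr (_ * _%:R)%:E; rewrite mem_setE in_itv.
rewrite ge0_integralZl_EFin//.
- rewrite integral_indic// setIT.
  have h : lebesgue_measure (`[0, e]%classic : set R) = e%:E.
    rewrite lebesgue_measure_itv/= lte_fin.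
    by case: ltrP => h; rewrite ?oppr0 ?adde0//; have -> : e = 0 by lra.
  by rewrite EFinM; congr (_ * _)%E; exact: h.
- by apply/measurable_EFinP; exact: measurable_indic.
Qed.

(** In the cone, [x 0 <= a 0 * normk k x <= a 0] and every coordinate is in [[0, 1]], so the cone
    lies in a box of volume [a 0]. The coordinates are integrated out one at a time, coordinate 0
    innermost. *)
Lemma volk_cone_le (R : realType) (k : nat) (a : nat -> R) :
  (0 < k)%N -> 0 <= a 0%N <= 1 -> (volk k (cone_le k a) <= (a 0%N)%:E)%E.
Proof.
move=> k0 /andP[a0 a1]; set e := a 0%N.
pose f := fun x : nat -> R => (\1_(cone_le k a) x)%:E : \bar R.
(* [bx j] is the indicator of the box constraints that remain after the coordinates below [j] have
   been integrated out. *)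
pose bx (j : nat) (x : nat -> R) : R :=
  \prod_(j <= i < k) (0 <= x i <= 1)%R%:R.
have bx0 j x : 0 <= bx j x by apply: prodr_ge0 => i _; rewrite ler0n.
have bxS j x t : (j < k)%N -> bx j (upd x j t) = (0 <= t <= 1)%R%:R * bx j.+1 x.
  move=> jk; rewrite /bx big_ltn// /upd eqxx; congr (_ * _).
  rewrite big_nat_cond [RHS]big_nat_cond; apply: eq_bigr => i /andP[/andP[ji _] _].
  by rewrite gtn_eqF.
have cone_bx x : cone_le k a x -> (0 <= x 0%N <= e) /\
    forall i, (i < k)%N -> 0 <= x i <= 1.
  move=> [xp [/andP[n0 n1] xa]].
  have xn i : (i < k)%N -> x i <= normk k x.
    move=> ik; rewrite /normk -[x i]ger0_norm ?xp// -sqrtr_sqr ler_sqrt.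
      rewrite (bigD1 (Ordinal ik))//= lerDl; apply: sumr_ge0 => j _; exact: sqr_ge0.
    by apply: sumr_ge0 => j _; exact: sqr_ge0.
  split; last by move=> i ik; rewrite xp//= (le_trans (xn i ik)).
  rewrite xp//=; have := xa _ k0; rewrite ler_pdivrMr// => h.
  by apply: (le_trans h); rewrite -[leRHS]mulr1; apply: ler_wpM2l.
have step j x : (j < k)%N -> (iint j.+1 f x <= (e * bx j.+1 x)%:E)%E.
  elim: j x => [|j IH] x jk.
    rewrite /= [(e * _)%R]mulrC -integral_mul_itv//.
    apply: le_integral_nonmeasurable => t; first by rewrite lee_fin mulr_ge0.
    rewrite /f lee_fin indicE; case: (boolP (_ \in _)) => [|_]; last by rewrite mulr_ge0.
    rewrite inE => /cone_bx[h1 h2].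
    have -> : (0 <= t <= e) = true by move: h1; rewrite /upd eqxx.
    rewrite mulr1 /bx big_nat_cond big1// => i /andP[/andP[i1 ik] _].
    by have := h2 _ ik; rewrite /upd gtn_eqF// => ->.
  change (\int[lebesgue_measure]_t iint j.+1 f (upd x j.+1 t) <=
    (e * bx j.+2 x)%:E)%E.
  rewrite -[(e * bx _ _)%R]mulr1 -integral_mul_itv ?mulr_ge0//.
  apply: le_integral_nonmeasurable => t; first by rewrite lee_fin !mulr_ge0.
  by apply: (le_trans (IH _ (ltnW jk))); rewrite bxS// lee_fin mulrCA mulrC.
rewrite /volk -/f; have := step k.-1 (fun=> 0); rewrite prednK// leqnn => /(_ isT).
by rewrite /bx big_geq// mulr1.
Qed.

(** This linear bound near 0 is what makes the inverse square root of the first coordinate of a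
    direction integrable. *)
Lemma sph_cdf_le (R : realType) (k : nat) (a : nat -> R) :
  (0 < k)%N -> 0 <= a 0%N <= 1 ->
  0 <= sph_cdf k a <= a 0%N / fine (volk k (cone_le k (fun _ => 1))).
Proof.
move=> k0 a01; have h := volk_cone_le k0 a01.
have v0 b : (0 <= volk k (cone_le (R:=R) k b))%E by apply: iint_ge0 => x; rewrite lee_fin.
have f1 : fine (volk k (cone_le k a)) <= a 0%N.
  by rewrite -lee_fin fineK// ge0_fin_numE//; apply: le_lt_trans h _; exact: ltry.
rewrite /sph_cdf divr_ge0 ?fine_ge0//=.
by apply: ler_wpM2r => //; rewrite invr_ge0 fine_ge0.
Qed.

Lemma integrable_norm_le1 (R : realType) (d : measure_display)
    (T : measurableType d) (P : probability T R) (f : T -> R) :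
  measurable_fun setT f -> (forall x, `|f x| <= 1) ->
  P.-integrable setT (EFin \o f).
Proof.
move=> mf f1; apply: measurable_bounded_integrable => //.
  by apply: le_lt_trans (probability_le1 P measurableT) _; exact: ltry.
by exists 1; split; [exact: num_real|move=> M M1 x _; exact: le_trans (f1 x) (ltW M1)].
Qed.

Lemma norm_prod_le1 (R : realType) (I : Type) (L : seq I) (f : I -> R) :
  (forall i, `|f i| <= 1) -> `|\prod_(i <- L) f i| <= 1.
Proof.
move=> f1; elim: L => [|i L IH]; first by rewrite big_nil normr1.
by rewrite big_cons normrM; apply: mulr_ile1.
Qed.

(** Induction on the number of indices of [L] in [up]. For such an index [q0], the event is [A]
    minus [B], where [A] drops the exclusion at [q0] and [B] moves the threshold there from [s] to
    [s']; both have one exclusion less, and the product is affine in its factor at [q0]. The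
    abstract form serves both the distribution functions of the profiles and the survival functions
    of the gaps. *)
Lemma product_law_setD (R : realType) (d : measure_display)
    (T : measurableType d) (P : probability T R)
    (I : eqType) (E : Type) (ok : E -> Prop) (L : seq I)
    (S : I -> E -> set T) (kap : I -> E -> T -> R) :
  uniq L ->
  (forall q s, ok s -> measurable (S q s)) ->
  (forall q s, measurable_fun setT (kap q s)) ->
  (forall q s w, ok s -> 0 <= kap q s w <= 1) ->
  (forall s : I -> E, (forall q, ok (s q)) ->
    P (\bigcap_(q in [set` L]) S q (s q)) =
    (\int[P]_w (\prod_(q <- L) kap q (s q) w)%:E)%E) ->
  forall (up : pred I) (s s' : I -> E),
  (forall q, ok (s q)) -> (forall q, ok (s' q)) ->
  (forall q, up q -> S q (s' q) `<=` S q (s q)) ->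
  P (\bigcap_(q in [set` L]) (S q (s q) `\` (if up q then S q (s' q) else set0))) =
  (\int[P]_w (\prod_(q <- L)
     (kap q (s q) w - (if up q then kap q (s' q) w else 0)))%:E)%E.
Proof.
move=> uL mS mk k01 law up.
move en : (count up L) => n; elim: n up en => [|n IH] up en s s' os os' ss'.
  have upF q : q \in L -> up q = false.
    move=> qL; apply/negbTE/negP => upq.
    have : has up L by apply/hasP; exists q.
    by rewrite has_count en.
  transitivity (P (\bigcap_(q in [set` L]) S q (s q))).
    by congr (P _); apply: eq_bigcapr => q /= qL; rewrite upF// setD0.
  rewrite law//; apply: eq_integral => w _; congr (_%:E).
  by apply: eq_big_seq => q qL; rewrite upF// subr0.
have [q0 q0L upq0] : exists2 q0, q0 \in L & up q0.
  by apply/hasP; rewrite has_count en.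
pose up1 q := up q && (q != q0).
have en1 : count up1 L = n.
  have /permP pc := perm_to_rem q0L.
  have := en; rewrite pc /= upq0 add1n => -[<-].
  rewrite pc /= /up1 eqxx andbF add0n.
  apply: eq_in_count => q; rewrite mem_rem_uniq// inE => /andP[qq0 _].
  by rewrite qq0 andbT.
pose s2 q := if q == q0 then s' q else s q.
have os2 q : ok (s2 q) by rewrite /s2; case: ifP.
have hA := IH up1 en1 s s' os os' _.
have hB := IH up1 en1 s2 s' os2 os' _.
set A := \bigcap_(q in _) _ in hA.
set B := \bigcap_(q in _) _ in hB.
have mAB (r : I -> E) : (forall q, ok (r q)) -> measurable
    (\bigcap_(q in [set` L]) (S q (r q) `\` (if up1 q then S q (s' q) else set0))).
  move=> okr; apply: fin_bigcap_measurable; first exact: finite_seq.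
  move=> q _; apply: measurableD; first exact: mS.
  by case: ifP => // _; exact: mS.
have BA : B `<=` A.
  move=> w Bw q qL; have := Bw q qL; rewrite /s2; case: eqP => [->|//].
  by rewrite /up1 eqxx andbF !setD0; exact: ss'.
have -> : \bigcap_(q in [set` L]) (S q (s q) `\` (if up q then S q (s' q) else set0))
    = A `\` B.
  apply/seteqP; split=> w.
    move=> h; split.
      move=> q qL; have [h1 h2] := h q qL; split=> // h3; apply: h2.
      by move: h3; rewrite /up1; case: (up q) => //=; case: (q != q0).
    move=> Bw; have := Bw q0 q0L; rewrite /s2 eqxx /up1 eqxx andbF setD0.
    by have [_] := h q0 q0L; rewrite upq0.
  move=> [Aw nB] q qL; have [h1 h2] := Aw q qL; split => //.
  have [qq0|qq0] := eqVneq q q0; last first.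
    by move: h2; rewrite /up1 qq0 andbT.
  rewrite qq0 upq0 => h3; apply: nB => q1 q1L; rewrite /s2.
  case: eqP => [->|q1q0]; last by have := Aw q1 q1L.
  by rewrite /up1 eqxx andbF setD0.
have -> : P (A `\` B) = (P A - P B)%E.
  rewrite measureD//; [|exact: mAB|exact: mAB|].
    by rewrite setIidr.
  by apply: le_lt_trans (probability_le1 _ _) _; [exact: mAB|exact: ltry].
rewrite hA ?hB; last 2 first.
- by move=> q /andP[upq qq0]; rewrite /s2 (negbTE qq0); exact: ss'.
- by move=> q /andP[upq _]; exact: ss'.
have intg (r : I -> E) : (forall q, ok (r q)) -> P.-integrable setT
   (EFin \o (fun w => \prod_(q <- L)
     (kap q (r q) w - (if up1 q then kap q (s' q) w else 0)))).
  move=> okr; apply: integrable_norm_le1.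
    apply: measurable_prod => q _; apply: measurable_funB => //.
    by case: (up1 q).
  move=> w; apply: norm_prod_le1 => q.
  have := k01 q _ w (okr q); have := k01 q _ w (os' q).
  by rewrite ler_norml; case: ifP => _; lra.
have := integralB measurableT (intg s os) (intg s2 os2) => /= <-.
apply: eq_integral => w _; rewrite -EFinB; congr (_%:E).
rewrite !(bigD1_seq q0)//= /s2 !eqxx /up1 !eqxx !andbF upq0 !subr0.
rewrite mulrBl; congr (_ * _ - _ * _).
  by apply: eq_bigr => q qq0; rewrite qq0 andbT.
by apply: eq_bigr => q qq0; rewrite qq0 andbT (negbTE qq0).
Qed.

Lemma measurable_dotm (R : realType) (d : measure_display) (T : measurableType d)
    (m : nat) (x y : T -> nat -> R) :
  (forall i, measurable_fun setT (fun w => x w i)) ->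
  (forall i, measurable_fun setT (fun w => y w i)) ->
  measurable_fun setT (fun w => dotm m (x w) (y w)).
Proof.
move=> mx my; apply: measurable_sum => i; exact: measurable_funM.
Qed.

Lemma dotm_ge0 (R : realType) (m : nat) (x y : nat -> R) :
  in_orthant_sphere m x -> in_orthant_sphere m y -> 0 <= dotm m x y.
Proof.
move=> [x0 _] [y0 _]; apply: sumr_ge0 => i _.
by rewrite mulr_ge0 ?x0 ?y0.
Qed.

Lemma dotm_le1 (R : realType) (m : nat) (x y : nat -> R) :
  in_orthant_sphere m x -> in_orthant_sphere m y -> dotm m x y <= 1.
Proof.
move=> [_ x1] [_ y1]; have : \sum_(i < m) (x i * y i) *+ 2 <= dotm m x x + dotm m y y.
  rewrite /dotm -big_split/=; apply: ler_sum => i _.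
  by have := sqr_ge0 (x i - y i); rewrite sqrrB -!expr2; lra.
by rewrite sumrMnl -/(dotm m x y) x1 y1 mulr2n; lra.
Qed.

Lemma dotm_ge2 (R : realType) (m : nat) (x y : nat -> R) : (2 <= m)%N ->
  in_orthant_sphere m x -> in_orthant_sphere m y -> x 1%N * y 1%N <= dotm m x y.
Proof.
move=> m2 [x0 _] [y0 _]; rewrite /dotm (bigD1 (Ordinal m2))//= lerDl.
by apply: sumr_ge0 => i _; rewrite mulr_ge0 ?x0 ?y0.
Qed.

Lemma dotm_e1 (R : realType) (m : nat) (x : nat -> R) : (0 < m)%N ->
  dotm m (e1 R) x = x 0%N.
Proof.
move=> m0; rewrite /dotm (bigD1 (Ordinal m0))//= /e1 eqxx mul1r big1 ?addr0//.
by move=> i; rewrite -val_eqE/= => /negbTE ->; rewrite mul0r.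
Qed.

Lemma orthant_coord_le1 (R : realType) (m : nat) (x : nat -> R) : (2 <= m)%N ->
  in_orthant_sphere m x -> 0 <= x 0%N <= 1.
Proof.
move=> m2 [x0 x1]; have m0 : (0 < m)%N by lia.
rewrite x0//=; have h : x 0%N ^+ 2 <= 1.
  rewrite -x1 /dotm (bigD1 (Ordinal m0))//= -expr2 lerDl.
  by apply: sumr_ge0 => i _; rewrite mulr_ge0 ?x0.
by rewrite -(@expr_le1 _ 2) ?x0.
Qed.

Lemma orthant_coordS_sqr (R : realType) (m : nat) (x : nat -> R) (i : nat) :
  in_orthant_sphere m x -> (i < m.-1)%N -> x i.+1 ^+ 2 <= 1 - x 0%N ^+ 2.
Proof.
move=> [x0 x1] im; have m0 : (0 < m)%N by lia.
have im1 : (i.+1 < m)%N by lia.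
rewrite -x1 /dotm (bigD1 (Ordinal m0))//= (bigD1 (Ordinal im1))//= -!expr2.
rewrite addrAC subrr add0r lerDl.
by apply: sumr_ge0 => j _; rewrite -expr2 sqr_ge0.
Qed.

Lemma dirS_bounds (R : realType) (m : nat) (x : nat -> R) (i : nat) :
  in_orthant_sphere m x -> (i < m.-1)%N -> 0 <= dirS x i <= 1.
Proof.
move=> xo im; have x1 := orthant_coordS_sqr xo im; have [x0 _] := xo.
have im1 : (i.+1 < m)%N by lia.
have xi := x0 _ im1.
have h : x i.+1 <= Num.sqrt (1 - x 0%N ^+ 2).
  by rewrite -[x i.+1]ger0_norm// -sqrtr_sqr ler_wsqrtr.
rewrite /dirS divr_ge0//=.
have [->|s0] := eqVneq (Num.sqrt (1 - x 0%N ^+ 2)) 0; first by rewrite invr0 mulr0.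
by rewrite ler_pdivrMr ?mul1r// lt_neqAle eq_sym s0 /=.
Qed.

Lemma angleS_spec (R : realType) (m : nat) (x : nat -> R) : (2 <= m)%N ->
  in_orthant_sphere m x ->
  [/\ 0 <= angleS x <= pi / 2, cos (angleS x) = x 0%N
    & sin (angleS x) * dirS x 0%N = x 1%N].
Proof.
move=> m2 xo; have /andP[x0 x1] := orthant_coord_le1 m2 xo.
have xI : -1 <= x 0%N <= 1 by apply/andP; split; lra.
have cE : cos (angleS x) = x 0%N by apply: acosK; rewrite in_itv.
split => //.
  rewrite acos_ge0//= leNgt; apply/negP => h.
  have := acos_lepi xI; rewrite -/(angleS x) => h2.
  have : cos (angleS x) < cos (pi / 2).
    by rewrite ltr_cos// in_itv/=; have := pi_gt0 R; rewrite /angleS in h h2 *; lra.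
  by rewrite cos_pihalf cE; lra.
rewrite /angleS sin_acos// /dirS.
have im : (0 < m.-1)%N by lia.
have := orthant_coordS_sqr xo im.
(* For a profile equal to that of [S] the direction is a division by 0, hence 0; the identity
   survives because coordinate 1 vanishes as well. *)
have [h|s0] := eqVneq (Num.sqrt (1 - x 0%N ^+ 2)) 0; last by move=> _; field.
move: h => /eqP; rewrite sqrtr_eq0 => h h2.
have : x 1%N ^+ 2 == 0 by rewrite eq_le sqr_ge0 andbT; lra.
by rewrite expf_eq0/= => /eqP ->; rewrite mul0r mulr0.
Qed.

Definition profile_le {R : realType} {T : Type} (k : nat) (x : T -> nat -> R)
    (s : R * (nat -> R)) : set T :=
  [set w | angleS (x w) <= s.1 /\ forall i, (i < k)%N -> dirS (x w) i <= s.2 i].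

Lemma measurable_profile_le (R : realType) (d : measure_display)
    (T : measurableType d) (m : nat) (x : T -> nat -> R) s : (2 <= m)%N ->
  (forall i, measurable_fun setT (fun w => x w i)) ->
  (forall w, in_orthant_sphere m (x w)) -> 0 <= s.1 <= pi / 2 ->
  measurable (profile_le m.-1 x s).
Proof.
move=> m2 mx xo /andP[s0 s1].
have msq : measurable_fun setT (fun w => Num.sqrt (1 - x w 0%N ^+ 2)).
  have h : measurable_fun setT (fun w => 1 - x w 0%N ^+ 2).
    by apply: measurable_funB => //; exact: measurable_funX.
  exact: measurableT_comp (continuous_measurable_fun (@sqrt_continuous R)) h.
have mle (f g : T -> R) : measurable_fun setT f -> measurable_fun setT g ->
    measurable [set w | f w <= g w].
  move=> mf mg; rewrite -[X in measurable X]setTI.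
  exact: (@measurable_fun_ler _ _ _ setT f g mf mg measurableT [set true]).
(* [acos] is decreasing and the denominator can be cleared. Where the denominator is 0 the direction
   is 0 by convention, and the cleared inequality is trivial: the conjunct [0 <= s.2 i] then carries
   the constraint. *)
have -> : profile_le m.-1 x s = [set w | cos s.1 <= x w 0%N] `&`
    \bigcap_(i in `I_m.-1) [set w | x w i.+1 <= s.2 i * Num.sqrt (1 - x w 0%N ^+ 2)
      /\ 0 <= s.2 i].
  apply/seteqP; split => w.
    move=> [h1 h2]; have [/andP[a0 a1] ca _] := angleS_spec m2 (xo w).
    have pp := pi_ge2 R.
    split.
      rewrite /= -ca; have [->//|ne] := eqVneq (angleS (x w)) s.1.
      by apply/ltW; rewrite ltr_cos ?in_itv/= ?lt_neqAle ?ne//; lra.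
    move=> i im /=; have /andP[d0 d1] := dirS_bounds (xo w) im.
    have h3 := h2 i im; split; last exact: le_trans h3.
    have := h3; rewrite /dirS.
    have [e|ne] := eqVneq (Num.sqrt (1 - x w 0%N ^+ 2)) 0; last first.
      by rewrite ler_pdivrMr// lt_neqAle eq_sym ne /=.
    move=> _; rewrite e mulr0; move/eqP: e; rewrite sqrtr_eq0 => e.
    have := orthant_coordS_sqr (xo w) im => h4.
    have : x w i.+1 ^+ 2 == 0 by rewrite eq_le sqr_ge0 andbT; lra.
    by rewrite expf_eq0/= => /eqP ->.
  move=> [h1 h2]; have [/andP[a0 a1] ca _] := angleS_spec m2 (xo w).
  have pp := pi_ge2 R.
  split.
    rewrite leNgt; apply/negP => h; move: h1; rewrite /= -ca leNgt => /negP; apply.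
    by rewrite ltr_cos// in_itv/=; lra.
  move=> i im; have /= [h3 h4] := h2 i im; rewrite /dirS.
  have [->|ne] := eqVneq (Num.sqrt (1 - x w 0%N ^+ 2)) 0; first by rewrite invr0 mulr0.
  by rewrite ler_pdivrMr// lt_neqAle eq_sym ne /=.
apply: measurableI; first exact: mle.
apply: fin_bigcap_measurable; first exact: finite_II.
move=> i _; case: (leP 0 (s.2 i)) => si.
  have -> : [set w | x w i.+1 <= s.2 i * Num.sqrt (1 - x w 0%N ^+ 2) /\ true] =
     [set w | x w i.+1 <= s.2 i * Num.sqrt (1 - x w 0%N ^+ 2)].
    by apply/seteqP; split => w /=; [case|].
  by apply: mle => //; exact: measurable_funM.
by rewrite (_ : [set w | _] = set0)// -subset0 => w [].
Qed.

Lemma iint_le (R : realType) (k : nat) (f g : (nat -> R) -> \bar R) :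
  (forall x, 0 <= g x)%E -> (forall x, f x <= g x)%E ->
  forall x, (iint k f x <= iint k g x)%E.
Proof.
move=> g0 fg; elim: k => [|k IH] x //=.
by apply: le_integral_nonmeasurable => t; [exact: iint_ge0|exact: IH].
Qed.

Lemma sph_cdf_le1 (R : realType) (k : nat) (a : nat -> R) :
  (0 < k)%N -> (forall i, a i <= 1) -> sph_cdf k a <= 1.
Proof.
move=> k0 a1; rewrite /sph_cdf.
set V := volk k (cone_le k (fun _ => 1)).
have V1 : (V <= 1%:E)%E by apply: (@volk_cone_le _ k (fun=> 1)) => //; rewrite ler01 lexx.
have v0 b : (0 <= volk k (cone_le (R:=R) k b))%E by apply: iint_ge0 => x; rewrite lee_fin.
have Vf : V \is a fin_num.
  by rewrite ge0_fin_numE ?v0//; apply: le_lt_trans V1 _; exact: ltry.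
have aV : (volk k (cone_le k a) <= V)%E.
  apply: iint_le => x; rewrite lee_fin// !indicE.
  case: (boolP (x \in cone_le k a)); rewrite ?ler0n// inE => -[h1 [h2 h3]].
  by rewrite mem_set//; split => //; split=> // i ik; apply: le_trans (h3 i ik) _.
have af : volk k (cone_le k a) \is a fin_num.
  by rewrite ge0_fin_numE ?v0//; apply: le_lt_trans aV _; rewrite -ge0_fin_numE ?v0.
have [->|Vn0] := eqVneq (fine V) 0; first by rewrite invr0 mulr0.
by rewrite ler_pdivrMr ?mul1r ?fine_le// lt_neqAle eq_sym Vn0 fine_ge0 ?v0.
Qed.

Lemma unif_cdfE (R : realType) (b : R) : 0 <= b <= pi / 2 -> unif_cdf b = b / (pi / 2).
Proof.
move=> /andP[b0 b1]; have p0 : 0 < pi / 2 :> R by have := pi_gt0 R; lra.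
have u0 : 0 <= b / (pi / 2) by apply: divr_ge0 => //; exact: ltW.
have u1 : b / (pi / 2) <= 1 by rewrite ler_pdivrMr// mul1r.
by rewrite /unif_cdf max_r// min_r.
Qed.

(** Each term is [2 * 2^-k]. The bound does not involve [K], so the truncation level may grow freely
    as [delta] tends to 0. *)
Lemma sum_dyadic_le (R : realType) (K : nat) :
  \sum_(k < K) 2 ^+ k.+1 * dyadic k <= 4 :> R.
Proof.
have -> : \sum_(k < K) 2 ^+ k.+1 * dyadic k = 2 * \sum_(k < K) (2^-1) ^+ k :> R.
  rewrite mulr_sumr; apply: eq_bigr => k _.
  rewrite exprS -mulrA /dyadic -exprMn; congr (_ * _ ^+ _); by field.
have := @sum_geometric_le R 2^-1 K; have -> : (1 - 2^-1)^-1 = 2 :> R by field.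
by move=> h; have := h _; lra.
Qed.

Lemma integral_cst_probability (R : realType) (d : measure_display)
    (T : measurableType d) (P : probability T R) (r : R) :
  (\int[P]_w r%:E = r%:E)%E.
Proof.
rewrite integral_cst//; transitivity (r%:E * 1)%E; last by rewrite mule1.
by congr (_ * _)%E; exact: probability_setT.
Qed.

Section profile_moments.
Variables (R : realType) (m n : nat) (d : measure_display) (T : measurableType d).
Variables (P : probability T R) (X : 'I_n.+2 -> T -> nat -> R).
Hypothesis m2 : (2 <= m)%N.
Hypothesis mX : forall v i, measurable_fun setT (fun w => X v w i).
Hypothesis Xo : forall v w, in_orthant_sphere m (X v w).
Hypothesis Xlaw : forall (b : 'I_n.+2 -> R) (a : 'I_n.+2 -> nat -> R),
  P (\bigcap_(v in [set v : 'I_n.+2 | v != nS])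
       [set w | angleS (X v w) <= b v /\
                forall i, (i < m.-1)%N -> dirS (X v w) i <= a v i])
  = (\prod_(v < n.+2 | v != nS) (unif_cdf (b v) * sph_cdf m.-1 (a v)))%:E.

Let V : R := fine (volk m.-1 (cone_le m.-1 (fun _ => 1))).
Let m1 : (0 < m.-1)%N. Proof. by lia. Qed.

(* Otherwise [sph_cdf] would vanish identically, by the convention x / 0 = 0,
   and the law could not have total mass 1. *)
Lemma fine_volk_cone_gt0 : 0 < V.
Proof.
have V0 : 0 <= V by apply: fine_ge0; apply: iint_ge0 => x; rewrite lee_fin.
rewrite lt_neqAle V0 andbT eq_sym; apply/eqP => V00.
have := Xlaw (fun=> pi / 2) (fun=> fun=> 1).
rewrite (_ : \bigcap_(v in _) _ = setT); last first.
  apply/seteqP; split => // w _ v _; split.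
    by have [/andP[]] := angleS_spec m2 (Xo v w).
  by move=> i im; have /andP[] := dirS_bounds (Xo v w) im.
rewrite probability_setT => -[].
have D : (nD : 'I_n.+2) != nS by rewrite -val_eqE/= inordK.
rewrite (bigD1 nD)//= /sph_cdf -/V V00 invr0 !mulr0 mul0r => /eqP.
by rewrite oner_eq0.
Qed.

Let nodes : seq 'I_n.+2 := [seq v <- index_enum 'I_n.+2 | v != nS].
Let nodes_set : [set` nodes] = [set v : 'I_n.+2 | v != nS].
Proof. by apply/seteqP; split=> v /=; rewrite mem_filter mem_index_enum andbT. Qed.

Let adm (s : R * (nat -> R)) : Prop :=
  [/\ 0 <= s.1 <= pi / 2, 0 <= s.2 0%N & forall i, s.2 i <= 1].
Let kap (s : R * (nat -> R)) : R := unif_cdf s.1 * sph_cdf m.-1 s.2.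

Lemma profile_law_setD (up : pred 'I_n.+2) (s s' : 'I_n.+2 -> R * (nat -> R)) :
  (forall v, adm (s v)) -> (forall v, adm (s' v)) ->
  (forall v, up v -> profile_le m.-1 (X v) (s' v) `<=` profile_le m.-1 (X v) (s v)) ->
  P (\bigcap_(v in [set v : 'I_n.+2 | v != nS])
      (profile_le m.-1 (X v) (s v) `\`
        (if up v then profile_le m.-1 (X v) (s' v) else set0))) =
  (\prod_(v < n.+2 | v != nS)
     (kap (s v) - (if up v then kap (s' v) else 0)))%:E.
Proof.
move=> os os' ss'; rewrite -nodes_set.
have law0 (r : 'I_n.+2 -> R * (nat -> R)) : (forall v, adm (r v)) ->
    P (\bigcap_(v in [set` nodes]) profile_le m.-1 (X v) (r v)) =
    (\int[P]_w (\prod_(v <- nodes) kap (r v))%:E)%E.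
  move=> _; rewrite nodes_set (Xlaw (fun v => (r v).1) (fun v => (r v).2)).
  by rewrite integral_cst_probability big_filter.
rewrite (@product_law_setD R d T P _ _ adm nodes
  (fun v s => profile_le m.-1 (X v) s) (fun _ s _ => kap s) _ _ _ _ law0 up s s')//.
- by rewrite integral_cst_probability big_filter.
- by rewrite filter_uniq// index_enum_uniq.
- by move=> v r [r1 _ _]; exact: measurable_profile_le.
- move=> v [b a] w [/= b01 a0 a1]; rewrite /kap/= unif_cdfE//.
  have p0 : 0 < pi / 2 :> R by have := pi_gt0 R; lra.
  have /andP[c0 _] : 0 <= sph_cdf m.-1 a <= a 0%N / V.
    by apply: sph_cdf_le => //; rewrite a0/=.
  have u0 : 0 <= b / (pi / 2) by apply: divr_ge0; [case/andP: b01|exact: ltW].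
  rewrite mulr_ge0//=; apply: mulr_ile1 => //; last exact: sph_cdf_le1.
  by rewrite ler_pdivrMr// mul1r; case/andP: b01.
Qed.

(** A constraint on the first coordinate of a direction only, since no coordinate of a direction
    exceeds 1. *)
Let cap (l : nat) : nat -> R := fun i => if i == 0%N then dyadic l else 1.

(** Up to constants, a truncation of the inverse square root of [x 0 * x 1] for the profile [x] of
    [v], because [x 0] is the cosine of the angle and [x 1] its sine times the first coordinate of
    the direction. *)
Definition profile_weight (K : nat) (v : 'I_n.+2) (w : T) : R :=
  psi_angle K (angleS (X v w)) * psi_len K (dirS (X v w) 0%N).

(** Each weight is a finite combination of indicators of events on one profile. The product is
    expanded over all choices of one indicator per node, and each resulting event has its
    probability given by [profile_law_setD]. Per node, the two ends of the angle interval and two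
    dyadic sums bounded by 4 give [2 * 4 * 4 / V]. *)
Lemma profile_weight_prod (K : nat) (Q : {set 'I_n.+2}) :
  (0 < K)%N -> nS \notin Q ->
  measurable_fun setT (fun w => \prod_(v in Q) profile_weight K v w) /\
  (\int[P]_w (\prod_(v in Q) profile_weight K v w)%:E <=
   ((32 / V) ^+ #|Q|)%:E)%E.
Proof.
move=> K0 SQ; have V0 := fine_volk_cone_gt0.
have p0 : 0 < pi / 2 :> R by have := pi_gt0 R; lra.
have p1 := pihalf_ge1 R.
(* An index holds the dyadic level of the angle, the end of the interval it is close to ([true] for
   0, [false] for [pi / 2]) and the level of the direction. Nodes outside [Q] only use the dummy
   index [j0], whose event is the whole space. *)
pose J : finType := ('I_K * bool * 'I_K)%type.
pose j0 : J := (Ordinal K0, true, Ordinal K0).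
pose s (v : 'I_n.+2) (j : J) : R * (nat -> R) :=
  if v \in Q then (if j.1.2 then dyadic j.1.1 else pi / 2, cap j.2)
  else (pi / 2, fun=> 1).
pose s' (v : 'I_n.+2) (j : J) : R * (nat -> R) := (pi / 2 - dyadic j.1.1, cap j.2).
pose up (v : 'I_n.+2) (j : J) := (v \in Q) && ~~ j.1.2.
pose C v j := profile_le m.-1 (X v) (s v j) `\`
        (if up v j then profile_le m.-1 (X v) (s' v j) else set0).
pose kk v j := kap (s v j) - (if up v j then kap (s' v j) else 0).
pose c (v : 'I_n.+2) (j : J) : R :=
  if v \in Q then 2 ^+ j.1.1.+1 * 2 ^+ j.2.+1 else (j == j0)%:R.
have c0 v j : 0 <= c v j.
  by rewrite /c; case: ifP => _; rewrite ?ler0n// mulr_ge0// exprn_ge0.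
have d0 k := dyadic_gt0 R k; have d1 k := dyadic_le1 R k.
have cap0 l : 0 <= cap l 0%N by rewrite /cap eqxx ltW.
have cap1 l i : cap l i <= 1 by rewrite /cap; case: ifP.
have adms v j : adm (s v j).
  rewrite /s; case: ifP => _; split => //=; last 1 first.
  - by have := p0; lra.
  - by case: ifP => _; have := d0 j.1.1; have := d1 j.1.1; lra.
have adms' v j : adm (s' v j).
  by split => //=; have := d0 j.1.1; have := d1 j.1.1; lra.
have Css v j : up v j ->
    profile_le m.-1 (X v) (s' v j) `<=` profile_le m.-1 (X v) (s v j).
  rewrite /up /s /s' => /andP[-> /negbTE ->] w [/= h1 h2]; split => //=.
  by apply: le_trans h1 _; have := d0 j.1.1; lra.
have PC (f : {ffun 'I_n.+2 -> J}) :
    P (\bigcap_(v in [set v : 'I_n.+2 | v != nS]) C v (f v)) =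
    (\prod_(v < n.+2 | v != nS) kk v (f v))%:E.
  apply: (@profile_law_setD (fun v => up v (f v)) (fun v => s v (f v))
    (fun v => s' v (f v))) => v; [exact: adms|exact: adms'|exact: Css].
have mC v j : measurable (C v j).
  have ms r : adm r -> measurable (profile_le m.-1 (X v) r).
    by case=> r1 _ _; exact: measurable_profile_le.
  by apply: measurableD; [exact: ms|case: ifP => // _; exact: ms].
have capP v w l : (forall i, (i < m.-1)%N -> dirS (X v w) i <= cap l i) <->
    dirS (X v w) 0%N <= dyadic l.
  split=> [/(_ _ m1)//|h i im]; rewrite /cap; case: eqP => [->//|_].
  by have /andP[] := dirS_bounds (Xo v w) im.
have weightE v w : v \in Q ->
    profile_weight K v w = \sum_(j : J) c v j * \1_(C v j) w.
  move=> vQ; rewrite /profile_weight /psi_angle /psi_len.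
  transitivity (\sum_(k < K) \sum_(b : bool) \sum_(l < K)
     c v (k, b, l) * \1_(C v (k, b, l)) w); last by rewrite !pair_bigA.
  rewrite big_distrl/=; apply: eq_bigr => k _.
  rewrite big_bool/= -big_split/= big_distrr/=; apply: eq_bigr => l _.
  rewrite /c vQ/= -mulrDr mulrACA -!mulrA; congr (_ * (_ * _)).
  have A1 : angleS (X v w) <= pi / 2 by have [/andP[]] := angleS_spec m2 (Xo v w).
  rewrite mulrDl; congr (_ + _); rewrite indicE -natrM mulnb; congr (_%:R : R);
    congr nat_of_bool; apply/idP/idP.
  - move=> /andP[h1 h2]; apply: mem_set; split.
      by rewrite /s vQ; split => //=; exact/capP.
    by rewrite /up vQ.
  - move=> /set_mem[]; rewrite /s vQ => -[/= h1 /capP h2] _.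
    by rewrite h1 h2.
  - move=> /andP[h1 h2]; apply: mem_set; split.
      by rewrite /s vQ; split => //=; exact/capP.
    by rewrite /up vQ/= => -[/=]; rewrite leNgt h1.
  - move=> /set_mem[]; rewrite /s /up vQ => -[/= h1 h2] h3.
    move/capP: (h2) => h4; rewrite h4 andbT ltNge; apply/negP => h5.
    by apply: h3; split.
have prodE w : \prod_(v in Q) profile_weight K v w =
    \sum_(f : {ffun 'I_n.+2 -> J}) ((f nS == j0)%:R *
      \prod_(v < n.+2 | v != nS) c v (f v)) *
      \1_(\bigcap_(v in [set v : 'I_n.+2 | v != nS]) C v (f v)) w.
  (* The law does not involve [S]; its factor selects the single index [j0], so that distributivity
     applies to the product over all nodes. *)
  pose F v j : R := if v == nS then (j == j0)%:R else c v j * \1_(C v j) w.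
  have F1 v : v \notin Q -> \sum_j F v j = 1.
    move=> vQ; rewrite (bigD1 j0)//= big1; last first.
      move=> j jj0; rewrite /F; case: ifP => _; first by rewrite (negbTE jj0).
      by rewrite /c (negbTE vQ) (negbTE jj0) mul0r.
    rewrite addr0 /F eqxx; case: ifP => // _.
    rewrite /c (negbTE vQ) eqxx mul1r indicE mem_set//.
    rewrite /C /s /up (negbTE vQ)/=; split => //.
    split => /=; first by have [/andP[]] := angleS_spec m2 (Xo v w).
    by move=> i im; have /andP[] := dirS_bounds (Xo v w) im.
  transitivity (\prod_v \sum_j F v j).
    rewrite [RHS](bigID (mem Q))/= [X in _ = _ * X]big1 ?mulr1//.
    apply: eq_bigr => v vQ; rewrite weightE//; apply: eq_bigr => j _.
    by rewrite /F; case: eqP => // vS; rewrite vS (negbTE SQ) in vQ.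
  rewrite bigA_distr_bigA/=; apply: eq_bigr => f _.
  rewrite (bigD1 nS)//= {1}/F eqxx -mulrA; congr (_ * _).
  have -> : \1_(\bigcap_(v in [set v : 'I_n.+2 | v != nS]) C v (f v)) w =
     \prod_(v < n.+2 | v != nS) \1_(C v (f v)) w :> R.
    rewrite indicE; case: (boolP (w \in _)).
      rewrite inE => h; rewrite big1// => v vS; rewrite indicE mem_set//.
      exact: h.
    move=> h; have [v vS vC] : exists2 v : 'I_n.+2, v != nS & w \notin C v (f v).
      apply: contrapT => h2; move/negP: h; apply; apply: mem_set => v vS.
      apply: contrapT => h3; apply: h2; exists v => //.
      by apply/negP => /set_mem.
    by rewrite (bigD1 v)//= indicE (negbTE vC) mul0r.
  rewrite -big_split/=; apply: eq_bigr => v vS.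
  by rewrite /F (negbTE vS).
have mCf (f : {ffun 'I_n.+2 -> J}) :
    measurable (\bigcap_(v in [set v : 'I_n.+2 | v != nS]) C v (f v)).
  by apply: fin_bigcap_measurable => // v _; exact: mC.
split.
  under eq_fun do rewrite prodE.
  by apply: measurable_sum => f; apply: measurable_funM => //; exact: measurable_indic.
have intE : (\int[P]_w (\prod_(v in Q) profile_weight K v w)%:E =
   (\prod_(v < n.+2 | v != nS) \sum_j c v j * kk v j)%:E)%E.
  under eq_integral do rewrite prodE -sumEFin.
  rewrite ge0_integral_sum//; last 2 first.
  - move=> f; apply/measurable_EFinP; apply: measurable_funM => //.
  - move=> f w _; rewrite lee_fin !mulr_ge0 ?ler0n//; apply: prodr_ge0 => v _.
    exact: c0.
  pose F v j : R := if v == nS then (j == j0)%:R else c v j * kk v j.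
  transitivity (\sum_(f : {ffun 'I_n.+2 -> J}) (\prod_v F v (f v)))%:E; last first.
    rewrite -bigA_distr_bigA (bigD1 nS)//=.
    rewrite (bigD1 j0)//= big1; last by move=> j /negbTE jj; rewrite /F eqxx jj.
    rewrite /F !eqxx addr0 mul1r; congr (_%:E); apply: eq_bigr => v vS.
    by rewrite (negbTE vS).
  rewrite -sumEFin; apply: eq_bigr => f _.
  under eq_integral do rewrite EFinM.
  rewrite ge0_integralZl_EFin//; last 2 first.
  - by apply/measurable_EFinP.
  - by rewrite mulr_ge0 ?ler0n//; apply: prodr_ge0 => v _; exact: c0.
  rewrite integral_indic// setIT.
  transitivity (((f nS == j0)%:R * \prod_(v < n.+2 | v != nS) c v (f v))%:E *
    (\prod_(v < n.+2 | v != nS) kk v (f v))%:E)%E.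
    by congr (_ * _)%E; exact: PC.
  rewrite -EFinM [in RHS](bigD1 nS)//= {1}/F eqxx -mulrA -big_split/=.
  congr (_ * _)%:E; apply: eq_bigr => v vS.
  by rewrite /F (negbTE vS).
rewrite intE lee_fin.
rewrite (bigID (mem Q))/= [X in _ * X]big1 ?mulr1; last first.
  move=> v /andP[vS vQ]; rewrite (bigD1 j0)//= big1; last first.
    by move=> j jj0; rewrite /c (negbTE vQ) (negbTE jj0) mul0r.
  rewrite /c (negbTE vQ) eqxx mul1r addr0 /kk /up /s (negbTE vQ)/= subr0 /kap/=.
  rewrite unif_cdfE; last by rewrite lexx (ltW p0).
  by rewrite mulfV ?gt_eqF// mul1r /sph_cdf mulfV// gt_eqF.
have -> : \prod_(v < n.+2 | (v != nS) && (v \in Q)) (\sum_j c v j * kk v j) =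
   \prod_(v in Q) (\sum_j c v j * kk v j).
  apply: eq_bigl => v; case: (boolP (v \in Q)) => vQ; rewrite ?andbF// andbT.
  by apply/eqP => vS; rewrite vS (negbTE SQ) in vQ.
rewrite -prodr_const; apply: ler_prod => v vQ.
(* Both ends of the angle interval carry the same mass, the angle being uniform. *)
have kkE j : kk v j = dyadic j.1.1 / (pi / 2) * sph_cdf m.-1 (cap j.2).
  rewrite /kk /kap /up /s vQ/=.
  have := d0 j.1.1; have := d1 j.1.1 => h1 h2.
  case: (j.1.2) => /=; first by rewrite subr0 unif_cdfE//; lra.
  rewrite unif_cdfE; last by rewrite lexx (ltW p0).
  rewrite unif_cdfE; last by lra.
  by rewrite -mulrBl -mulrBl opprB addrC subrK.
have sc l : 0 <= sph_cdf m.-1 (cap l) <= dyadic l / V.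
  by have := @sph_cdf_le R m.-1 (cap l) m1; rewrite cap0 cap1; exact.
have kk0 j : 0 <= kk v j <= dyadic j.1.1 * (dyadic j.2 / V).
  rewrite kkE; have /andP[h1 h2] := sc j.2.
  have q0 : 0 <= dyadic j.1.1 / (pi / 2) :> R.
    by apply: divr_ge0; exact: ltW.
  rewrite (mulr_ge0 q0 h1)/=; apply: ler_pM => //.
  by rewrite ler_pdivrMr// ler_peMr// ltW.
apply/andP; split.
  by apply: sumr_ge0 => j _; rewrite mulr_ge0//; case/andP: (kk0 j).
apply: (@le_trans _ _ (\sum_(j : J) (2 ^+ j.1.1.+1 * dyadic j.1.1) *
   ((2 ^+ j.2.+1 * dyadic j.2) / V))).
  apply: ler_sum => j _; rewrite /c vQ.
  rewrite [leRHS](_ : _ = (2 ^+ j.1.1.+1 * 2 ^+ j.2.+1) *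
    (dyadic j.1.1 * (dyadic j.2 / V))); last by ring.
  by apply: ler_wpM2l; [rewrite mulr_ge0// exprn_ge0|case/andP: (kk0 j)].
set D := \sum_(k < K) 2 ^+ k.+1 * dyadic k : R.
have -> : \sum_(j : J) (2 ^+ j.1.1.+1 * dyadic j.1.1) *
   ((2 ^+ j.2.+1 * dyadic j.2) / V) = 2 * D * D / V.
  transitivity (\sum_(k < K) \sum_(b : bool) \sum_(l < K)
     (2 ^+ k.+1 * dyadic k) * ((2 ^+ l.+1 * dyadic l) / V) : R).
    by rewrite !pair_bigA.
  under eq_bigr do rewrite sumr_const card_bool -mulr_sumr -mulr_suml -/D -mulrnAr.
  by rewrite -mulr_suml -/D -mulr_natl; ring.
have D0 : 0 <= D.
  by apply: sumr_ge0 => k _; rewrite mulr_ge0 ?exprn_ge0// ltW.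
have D4 : D <= 4 by exact: sum_dyadic_le.
rewrite ler_pM2r ?invr_gt0//.
have : D * D <= 4 * 4 by exact: ler_pM.
by lra.
Qed.
End profile_moments.

(** * Meeting processes and delivery time *)

(** At least [x] natural numbers lie below [x]. This is a discrete layer-cake bound: expectations of
    times become sums of tail probabilities at integer times. *)
Lemma nneseries_count_ge (R : realType) (x : R) (u : nat -> \bar R) :
  (forall t, 0 <= u t)%E -> (forall t : nat, t%:R < x -> (1%:E <= u t)%E) ->
  (x%:E <= \sum_(t <oo) u t)%E.
Proof.
move=> u0 ux.
have ex : exists N : nat, x <= N%:R.
  exists (Num.bound `|x|); apply: le_trans (ler_norm x) _; exact/ltW/archi_boundP.
case: (ex_minnP ex) => N xN Nmin.
apply: (@le_trans _ _ (\sum_(0 <= t < N) u t)%E); last first.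
  by apply: nneseries_lim_ge => t _ _; exact: u0.
apply: (@le_trans _ _ (N%:R)%:E); first by rewrite lee_fin.
rewrite big_mkord; apply: (@le_trans _ _ (\sum_(t < N) 1%:E)%E).
  by rewrite sumEFin sumr_const card_ord.
apply: lee_sum => t _; apply: ux; rewrite ltNge; apply/negP => /Nmin.
by rewrite leqNgt ltn_ord.
Qed.

Lemma bigmin_mem (R : realType) (I : finType) (D : pred I) (F : I -> R) (x : R) :
  \big[Num.min/x]_(v | D v) F v = x \/
  exists2 v, D v & F v = \big[Num.min/x]_(v | D v) F v.
Proof.
apply: (big_ind (fun y => y = x \/ exists2 v, D v & F v = y)); first by left.
  by move=> y z hy hz; rewrite /Num.min; case: ifP.
by move=> v Dv; right; exists v.
Qed.

Lemma min_multiple_lt (R : realType) (h x : R) : 0 < h -> 0 < x ->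
  exists q : nat, q%:R * h < x <= q.+1%:R * h.
Proof.
move=> h0 x0.
have ex : exists N : nat, x <= N.+1%:R * h.
  exists (Num.bound (x / h)); rewrite -ler_pdivrMr//.
  apply: ltW; apply: lt_trans (archi_boundP _) _; last by rewrite ltr_nat.
  by rewrite ltW// divr_gt0.
case: (ex_minnP ex) => -[|N] xN Nmin; first by exists 0%N; rewrite mul0r x0.
exists N.+1; rewrite xN andbT ltNge; apply/negP => /Nmin.
by rewrite ltnn.
Qed.

Lemma measurable_fun_inv (R : realType) (d : measure_display)
    (T : measurableType d) (f : T -> R) :
  measurable_fun setT f -> (forall x, 0 <= f x) ->
  measurable_fun setT (fun x => (f x)^-1).
Proof.
move=> mf f0; under eq_fun do rewrite -powR_inv1//.
exact: measurableT_comp (measurable_powR _) mf.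
Qed.

Lemma profile_weight_cases (R : realType) (m K : nat) (x : nat -> R) :
  (2 <= m)%N -> (0 < K)%N -> in_orthant_sphere m x ->
  let W := psi_angle K (angleS x) * psi_len K (dirS x 0%N) in
  1 <= W /\ (2 ^+ K <= W \/ cos 1 / 2 <= W ^+ 2 * (x 0%N * x 1%N)).
Proof.
move=> m2 K0 xo W; have m1 : (0 < m.-1)%N by lia.
have [a01 cE sE] := angleS_spec m2 xo.
have /andP[d0 d1] := dirS_bounds xo m1.
have [p1 pc] := psi_angle_cases K0 a01; have [l1 lc] := psi_len_cases K0 d1.
have W1 : 1 <= W by rewrite -[leLHS]mulr1; apply: ler_pM.
split => //; case: pc => [pc|pc].
  by left; apply: le_trans pc _; rewrite ler_peMr//; lra.
case: lc => [lc|lc].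
  by left; apply: le_trans lc _; rewrite ler_peMl//; lra.
right; rewrite -cE -sE /W exprMn mulrA.
set A := psi_angle K (angleS x) ^+ 2 in pc *; set L := psi_len K (dirS x 0%N) ^+ 2 in lc *.
have -> : A * L * cos (angleS x) * (sin (angleS x) * dirS x 0%N) =
  (A * (cos (angleS x) * sin (angleS x))) * (L * dirS x 0%N) by ring.
rewrite -[leLHS]mulr1; apply: ler_pM => //; have := cos1_gt0 R; lra.
Qed.

(** If one weight has reached its truncation level, the crude bound [mu >= delta] suffices, as
    [delta^-1 <= 2 ^+ K]. Otherwise the two lower bounds multiply, and [4 * (xa * xb) <= y ^+ 2], an
    arithmetic-geometric mean inequality in the applications, yields
    [k * y * (Wa * Wb) >= 2 * k * kap]. *)
Lemma inv_le_weights (R : realType) (K : nat) (kap k delta mu y Wa Wb xa xb : R) :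
  0 < kap -> 0 < k -> 0 < delta -> delta <= mu -> k * y <= mu -> 0 <= y ->
  4 * (xa * xb) <= y ^+ 2 -> 1 <= delta * 2 ^+ K ->
  1 <= Wa /\ (2 ^+ K <= Wa \/ kap <= Wa ^+ 2 * xa) ->
  1 <= Wb /\ (2 ^+ K <= Wb \/ kap <= Wb ^+ 2 * xb) ->
  mu^-1 <= (1 + (2 * k * kap)^-1) * (Wa * Wb).
Proof.
move=> kap0 k0 d0 dmu kmu y0 xy dK [a1 ac] [b1 bc].
have mu0 : 0 < mu by exact: lt_le_trans dmu.
set W := Wa * Wb.
have W1 : 1 <= W by rewrite -[leLHS]mulr1; apply: ler_pM.
have c0 : 0 < 2 * k * kap by rewrite !mulr_gt0.
have i0 : 0 < (2 * k * kap)^-1 by rewrite invr_gt0.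
have big : 2 ^+ K <= W -> mu^-1 <= (1 + (2 * k * kap)^-1) * W.
  move=> KW; apply: (@le_trans _ _ W); last by rewrite ler_peMl//; lra.
  rewrite -[leRHS]mul1r -ler_pdivrMr; last by lra.
  rewrite -invfM invf_le1; last by rewrite mulr_gt0//; lra.
  by apply: le_trans dK _; apply: ler_pM => //; exact: ltW.
case: ac => [ac|ac]; first by apply: big; apply: le_trans ac _; rewrite ler_peMr//; lra.
case: bc => [bc|bc]; first by apply: big; apply: le_trans bc _; rewrite ler_peMl//; lra.
have h : kap * kap <= (Wa ^+ 2 * xa) * (Wb ^+ 2 * xb) by apply: ler_pM => //; exact: ltW.
have h2 : (2 * k * kap) ^+ 2 <= (k * y * W) ^+ 2.
  have -> : (2 * k * kap) ^+ 2 = 4 * k ^+ 2 * (kap * kap) by ring.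
  have e2 : 4 * k ^+ 2 * ((Wa ^+ 2 * xa) * (Wb ^+ 2 * xb)) =
    k ^+ 2 * W ^+ 2 * (4 * (xa * xb)) by rewrite /W; ring.
  have -> : (k * y * W) ^+ 2 = k ^+ 2 * W ^+ 2 * y ^+ 2 by ring.
  apply: (@le_trans _ _ (4 * k ^+ 2 * ((Wa ^+ 2 * xa) * (Wb ^+ 2 * xb)))).
    by apply: ler_wpM2l h; rewrite mulr_ge0// sqr_ge0.
  by rewrite e2; apply: ler_wpM2l xy; rewrite mulr_ge0// sqr_ge0.
have h3 : 2 * k * kap <= mu * W.
  apply: (@le_trans _ _ (k * y * W)); last by apply: ler_wpM2r kmu; lra.
  rewrite -(@ler_pXn2r _ 2)// nnegrE; first exact: ltW.
  by rewrite !mulr_ge0//; lra.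
apply: (@le_trans _ _ ((2 * k * kap)^-1 * W)); last by apply: ler_wpM2r; lra.
rewrite -ler_pdivrMr; last by lra.
rewrite -invfM lef_pV2 ?posrE//; apply: mulr_gt0 => //; lra.
Qed.

Lemma expR_mul_nat (R : realType) (x : R) (k : nat) : expR (- (x * k%:R)) = expR (- x) ^+ k.
Proof. by rewrite -expRM_natr mulNr. Qed.

Section gap_boxes.
Variables (R : realType) (m n : nat) (lam delta : R) (d : measure_display).
Variables (T : measurableType d) (P : probability T R).
Variables (X : 'I_n.+2 -> T -> nat -> R) (G : 'I_n.+2 -> 'I_n.+2 -> nat -> T -> R).
Let Q : Type := ('I_n.+2 * 'I_n.+2 * nat)%type.
Let rate (a b : 'I_n.+2) (w : T) : R := rate_ib m lam delta (X a w) (X b w).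
Hypothesis n2 : (2 <= n)%N.
Hypothesis m2 : (2 <= m)%N.
Hypothesis delta0 : 0 < delta.
Hypothesis delta_lam : delta <= lam.
Hypothesis mX : forall v i, measurable_fun setT (fun w => X v w i).
Hypothesis mG : forall a b l, measurable_fun setT (G a b l).
Hypothesis XS : forall w, X nS w = e1 R.
Hypothesis Xo : forall v w, in_orthant_sphere m (X v w).
Hypothesis Glaw : forall (L : seq Q) (s : Q -> R), uniq L ->
  all (fun q : Q => (q.1.1 < q.1.2)%N) L -> (forall q, q \in L -> 0 <= s q) ->
  P (\bigcap_(q in [set` L]) [set w | s q < G q.1.1 q.1.2 q.2 w])
  = (\int[P]_w (\prod_(q <- L) expR (- rate q.1.1 q.1.2 w * s q))%:E)%E.

Lemma measurable_rate a b : measurable_fun setT (rate a b).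
Proof.
apply: measurable_funD => //; apply: measurable_funM => //.
exact: measurable_dotm.
Qed.

Lemma rate_ge a b w : delta <= rate a b w.
Proof.
rewrite /rate /rate_ib lerDr; apply: mulr_ge0; last exact: dotm_ge0.
by apply: mulr_ge0; [have := pi_ge0 R; lra|rewrite subr_ge0].
Qed.

Lemma rate_le a b w : rate a b w <= 2 * lam.
Proof.
have k0 : 0 <= pi / 2 * (lam - delta).
  by apply: mulr_ge0; [have := pi_ge0 R; lra|rewrite subr_ge0].
have := ler_wpM2l k0 (dotm_le1 (Xo a w) (Xo b w)); rewrite -/(rate a b w) mulr1.
have : pi / 2 * (lam - delta) <= 2 * (lam - delta).
  by apply: ler_wpM2r; [rewrite subr_ge0|exact/ltW/pihalf_lt2].
move=> h1 h2; rewrite /rate /rate_ib.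
apply: le_trans (lerD (le_trans h2 h1) (lexx delta)) _.
by have := delta0; lra.
Qed.

Lemma rate_gt0 a b w : 0 < rate a b w.
Proof. exact: lt_le_trans (rate_ge a b w). Qed.

(** The box is written with differences of survival events because the model specifies the law of
    the gaps through those; [bd] selects the gaps that are also bounded above. *)
Definition gap_box (L : seq Q) (lo hi : Q -> R) (bd : pred Q) : set T :=
  \bigcap_(q in [set` L]) ([set w | lo q < G q.1.1 q.1.2 q.2 w] `\`
     (if bd q then [set w | hi q < G q.1.1 q.1.2 q.2 w] else set0)).

Lemma measurable_gap_gt (q : Q) (s : R) :
  measurable [set w | s < G q.1.1 q.1.2 q.2 w].
Proof.
have := mG q.1.1 q.1.2 q.2 measurableT (measurable_itv `]s, +oo[).
rewrite setTI; congr measurable.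
by apply/seteqP; split => w /=; rewrite in_itv/= andbT.
Qed.

Lemma measurable_gap_box L lo hi bd : measurable (gap_box L lo hi bd).
Proof.
apply: fin_bigcap_measurable; first exact: finite_seq.
move=> q _; apply: measurableD; first exact: measurable_gap_gt.
by case: ifP => // _; exact: measurable_gap_gt.
Qed.

Lemma gap_box_law (L : seq Q) (lo hi : Q -> R) (bd : pred Q) : uniq L ->
  all (fun q : Q => (q.1.1 < q.1.2)%N) L -> (forall q, 0 <= lo q) ->
  (forall q, 0 <= hi q) -> (forall q, bd q -> lo q <= hi q) ->
  P (gap_box L lo hi bd) =
  (\int[P]_w (\prod_(q <- L) (expR (- (rate q.1.1 q.1.2 w * lo q)) -
     (if bd q then expR (- (rate q.1.1 q.1.2 w * hi q)) else 0)))%:E)%E.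
Proof.
move=> uL aL lo0 hi0 lohi.
apply: (@product_law_setD R d T P Q R (fun s => 0 <= s) L
  (fun q s => [set w | s < G q.1.1 q.1.2 q.2 w])
  (fun q s w => expR (- (rate q.1.1 q.1.2 w * s)))) => //.
- by move=> q s _; exact: measurable_gap_gt.
- move=> q s; apply: measurableT_comp => //; apply: measurableT_comp => //.
  by apply: measurable_funM => //; exact: measurable_rate.
- move=> q s w s0; rewrite expR_ge0/= -expR0 ler_expR oppr_le0 mulr_ge0//.
  exact/ltW/rate_gt0.
- move=> s s0; rewrite Glaw//; apply: eq_integral => w _.
  by congr (_%:E); apply: eq_bigr => q _; rewrite mulNr.
- by move=> q bq w /=; apply: le_lt_trans; exact: lohi.
Qed.

Lemma gap_le0_negligible (a b : 'I_n.+2) l : (a < b)%N ->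
  P.-negligible [set w | G a b l w <= 0].
Proof.
move=> ab; have := Glaw (L := [:: (a, b, l)]) (s := fun=> 0) _ _ _.
rewrite /= ab => /(_ isT isT (fun _ _ => lexx _)).
under eq_integral do rewrite big_seq1/= mulr0 expR0.
rewrite integral_cst_probability.
rewrite (_ : \bigcap_(q in _) _ = ~` [set w | G a b l w <= 0]); last first.
  apply/seteqP; split => w /=.
    move=> h; apply/negP; rewrite -ltNge.
    by have := h (a, b, l) (mem_head _ _).
  by move=> /negP h q /=; rewrite inE => /eqP -> /=; rewrite ltNge.
have mA : measurable [set w | G a b l w <= 0].
  rewrite (_ : [set w | _] = ~` [set w | 0 < G a b l w]).
    by apply: measurableC; exact: (measurable_gap_gt (a, b, l)).
  apply/seteqP; split => w /=; rewrite leNgt; last by move=> /negP.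
  by move=> /negP.
rewrite probability_setC// => h; apply/(negligibleP _ mA).
have fA : P [set w | G a b l w <= 0] \is a fin_num by exact: fin_num_measure.
move: h; rewrite -(fineK fA) -EFinB => -[] h.
transitivity ((fine (P [set w | G a b l w <= 0]))%:E); first exact: esym (fineK fA).
by congr (_%:E); lra.
Qed.

(** Rates are at most [2 * lam], so the first [M] gaps all lie in []0, x]] with probability at most
    [y ^+ M], with [y < 1] independent of the profiles. Hence almost surely some gap exceeds any
    given grid point. *)
Lemma gap_bounded_negligible (a b : 'I_n.+2) (x : R) : (a < b)%N -> 0 <= x ->
  P.-negligible [set w | forall l, 0 < G a b l w <= x].
Proof.
move=> ab x0; set A := [set w | _].
pose L M : seq Q := [seq (a, b, l) | l <- iota 0 M].
have LE M : P (gap_box (L M) (fun=> 0) (fun=> x) predT) =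
   (\int[P]_w ((1 - expR (- (rate a b w * x))) ^+ M)%:E)%E.
  rewrite gap_box_law//; last 2 first.
  - by rewrite map_inj_uniq ?iota_uniq// => i j [].
  - by apply/allP => q /mapP[l _ ->].
  apply: eq_integral => w _; congr (_%:E); rewrite big_map.
  under eq_bigr do rewrite mulr0 oppr0 expR0.
  transitivity (\prod_(l <- iota 0 M) (1 - expR (- (rate a b w * x)))) => //.
  by rewrite big_const_seq count_predT size_iota iter_mulr_1.
have AE : A = \bigcap_M gap_box (L M) (fun=> 0) (fun=> x) predT.
  apply/seteqP; split => w.
    move=> Aw M _ q /= /mapP[l _ ->] /=; have /andP[g0 gx] := Aw l.
    by split => //=; rewrite ltNge gx.
  move=> h l; have := h l.+1 I (a, b, l); rewrite /= => /(_ _)[].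
    by apply/mapP; exists l => //; rewrite mem_iota/= add0n ltnS.
  by move=> -> /negP; rewrite -leNgt.
have mA : measurable A.
  by rewrite AE; apply: bigcapT_measurable => M; exact: measurable_gap_box.
set y := 1 - expR (- (2 * lam * x)).
have lam0 : 0 <= 2 * lam by have := lt_le_trans delta0 delta_lam; lra.
have y0 : 0 <= y by apply: onem_expR_ge0; exact: mulr_ge0.
have y1 : y < 1 by rewrite /y; have := expR_gt0 (- (2 * lam * x)); lra.
have Py M : (P A <= (y ^+ M)%:E)%E.
  apply: (@le_trans _ _ (P (gap_box (L M) (fun=> 0) (fun=> x) predT))).
    apply: le_measure; rewrite ?inE//; first exact: measurable_gap_box.
    by rewrite AE => w /(_ M I).
  rewrite LE -(integral_cst_probability P (y ^+ M)).
  apply: le_integral_nonmeasurable => w; rewrite lee_fin.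
    by rewrite exprn_ge0.
  have rx : 0 <= rate a b w * x by rewrite mulr_ge0// ltW// rate_gt0.
  apply: lerXn2r; rewrite ?nnegrE//; first exact: onem_expR_ge0.
  rewrite /y lerD2l lerN2 ler_expR lerN2; apply: ler_wpM2r => //.
  exact: rate_le.
apply/(negligibleP _ mA)/eqP; rewrite eq_le measure_ge0 andbT.
have yc : (y ^+ k)%:E @[k --> \oo] --> 0%:E.
  by apply: cvg_EFin; [exact: nearW|apply: cvg_expr; rewrite ger0_norm].
have <- : limn (fun k => (y ^+ k)%:E) = 0%E by exact: cvg_lim yc.
apply: lime_ge; first by apply/cvg_ex; exists 0%E.
exact: nearW.
Qed.

Let nodes : seq 'I_n.+2 := [seq v <- index_enum 'I_n.+2 | v != nS].
Let nSE : val (nS : 'I_n.+2) = 0%N. Proof. by []. Qed.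
Let nDE : val (nD : 'I_n.+2) = 1%N. Proof. by rewrite /= inordK. Qed.

Lemma is_relayE (v : 'I_n.+2) : is_relay v = (v != nS) && (v != nD).
Proof. by rewrite /is_relay -!val_eqE nSE nDE /=; case: (val v) => [|[|]]. Qed.

Let relayA : 'I_n.+2 := inord 2.
Let relayB : 'I_n.+2 := inord 3.
Let relayAE : val relayA = 2%N. Proof. by rewrite /= inordK//; lia. Qed.
Let relayBE : val relayB = 3%N. Proof. by rewrite /= inordK//; lia. Qed.
Let relayAP : is_relay relayA. Proof. by rewrite /is_relay relayAE. Qed.
Let relayBP : is_relay relayB. Proof. by rewrite /is_relay relayBE. Qed.

Definition relay_rate (j : 'I_n.+2) (w : T) : R :=
  \sum_(v < n.+2 | is_relay v && (v != j)) rate nS v w.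

(** If [S] has met no relay by time [t], it has met neither of two fixed ones. Two are used because
    [1 / (cos a + cos b)] has finite expectation and [1 / cos a] has not. *)
Definition early_box (t : nat) : set T :=
  gap_box [:: (nS, relayA, 0%N); (nS, relayB, 0%N)] (fun=> t%:R) (fun=> 0) pred0.

(* For a relay [j] met first, at an instant of the [q]-th cell of the grid of
   step [h]: [D] is not met by [S] before [t], and the first gap of {j, D}
   exceeding the end [a] of the cell is the [i]-th one and exceeds [a + t]. *)
Definition late_box (h : R) (j : 'I_n.+2) (q t i : nat) : set T :=
  gap_box ([seq (nS, v, 0%N) | v <- nodes] ++ [seq (nD, j, l) | l <- iota 0 i.+1])
    (fun x : Q => if x.1.1 == nS then (if x.1.2 == nD then t%:R else q%:R * h)
                  else (if x.2 == i then q.+1%:R * h + t%:R else 0))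
    (fun=> q.+1%:R * h)
    (fun x : Q => if x.1.1 == nS then x.1.2 == j else (x.2 < i)%N).

Lemma early_box_law t : P (early_box t) =
  (\int[P]_w (expR (- (rate nS relayA w + rate nS relayB w)) ^+ t)%:E)%E.
Proof.
rewrite /early_box gap_box_law//.
- apply: eq_integral => w _; congr (_%:E).
  by rewrite big_cons big_seq1/= !subr0 -expRD -expR_mul_nat; congr expR; ring.
- rewrite /= inE andbT; apply/eqP => -[] /(congr1 val).
  by rewrite relayAE relayBE.
- by rewrite /= relayAE relayBE.
Qed.

Lemma late_box_law (h : R) (j : 'I_n.+2) (q t i : nat) : 0 <= h -> is_relay j ->
  P (late_box h j q t i) =
  (\int[P]_w (expR (- (rate nS nD w * t%:R)) *
    ((expR (- (rate nS j w * (q%:R * h))) - expR (- (rate nS j w * (q.+1%:R * h)))) *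
     expR (- (relay_rate j w * (q%:R * h)))) *
    ((1 - expR (- (rate nD j w * (q.+1%:R * h)))) ^+ i *
     expR (- (rate nD j w * (q.+1%:R * h + t%:R)))))%:E)%E.
Proof.
move=> h0 jr; have /andP[jS jD] : (j != nS) && (j != nD) by rewrite -is_relayE.
have DS : (nD : 'I_n.+2) != nS by rewrite -val_eqE nDE nSE.
have inS : injective (fun v : 'I_n.+2 => ((nS, v, 0%N) : Q)) by move=> u v [].
have inD : injective (fun l : nat => ((nD, j, l) : Q)) by move=> u v [].
have qh k : 0 <= k%:R * h by rewrite mulr_ge0.
rewrite /late_box gap_box_law//.
- apply: eq_integral => w _; congr (_%:E).
  rewrite big_cat !big_map big_filter; congr (_ * _).
    rewrite (bigD1 nD)//= (bigD1 j) ?jS//= !eqxx (negbTE jD) eq_sym (negbTE jD) subr0.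
    congr (_ * (_ * _)).
    rewrite /relay_rate mulr_suml -sumrN expR_sum.
    apply: eq_big => [v|v]; first by rewrite is_relayE.
    by move=> /andP[/andP[_ vD] vj]; rewrite (negbTE vD) (negbTE vj) subr0.
  rewrite -[iota 0 i.+1]/(index_iota 0 i.+1) big_nat_recr//= (negbTE DS) eqxx ltnn subr0.
  congr (_ * _); rewrite big_mkord.
  under eq_bigr => l _ do rewrite ltn_ord ltn_eqF// mulr0 oppr0 expR0.
  by rewrite prodr_const card_ord.
- rewrite cat_uniq; apply/and3P; split.
    by rewrite map_inj_uniq// filter_uniq// index_enum_uniq.
    2: by rewrite map_inj_uniq// iota_uniq.
  apply/hasPn => x /mapP[l _ ->]; apply/negP => /mapP[v _ [] /eqP].
  by rewrite (negbTE DS).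
- rewrite all_cat; apply/andP; split; apply/allP => x /mapP[v].
    rewrite mem_filter => /andP[vS _] -> /=; move: vS; rewrite -val_eqE nSE /=.
    by case: (val v).
  move=> _ -> /=; move: jr; rewrite /is_relay => jr; by rewrite nDE.
- by move=> x; case: ifP => _; case: ifP => _ //; rewrite addr_ge0.
- move=> x; case: ifP => _.
    move=> /eqP ->; rewrite (negbTE jD); apply: ler_wpM2r => //; by rewrite ler_nat.
  by move=> xi; rewrite ltn_eqF.
Qed.

Let arrivalS g (v : 'I_n.+2) : v != nS -> arrival g nS v 0 = g nS v 0%N :> R.
Proof.
by move=> vS; rewrite /arrival big_ord1 /gap lt0n -[nat_of_ord v]/(val v) -nSE val_eqE vS.
Qed.

(** A pathwise bound. The first series is at least [tau]. When a relay [j] is met first, in the cell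
    ending at [a <= tau + h], each integer [t] such that delivery occurs after [2 * a + t] puts [w]
    in some [late_box h j q t i], so the last sum is at least the excess over [2 * a]. *)
Lemma delivery_FM_le (h : R) (w : T) : 0 < h ->
  (forall (a b : 'I_n.+2) l, (a < b)%N -> 0 < G a b l w) ->
  (forall (j : 'I_n.+2) (q : nat), is_relay j ->
     exists l, q.+1%:R * h < G nD j l w) ->
  (delivery_FM (fun a b l => G a b l w) <=
   (2 * h)%:E + 2%:E * (\sum_(t <oo) (\1_(early_box t) w)%:E) +
   \sum_(j < n.+2 | is_relay j) \sum_(q <oo) \sum_(t <oo) \sum_(i <oo)
     (\1_(late_box h j q t i) w)%:E)%E.
Proof.
move=> h0 Gp Gu; set g := fun a b l => G a b l w.
set E := (\sum_(t <oo) (\1_(early_box t) w)%:E)%E.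
set F := (\sum_(j < n.+2 | is_relay j) _)%E.
have ind0 (A : set T) : (0 <= (\1_A w : R)%:E)%E by rewrite lee_fin.
have F3 j q t : (0 <= \sum_(i <oo) (\1_(late_box h j q t i) w : R)%:E)%E.
  by apply: nneseries_ge0.
have F2 j q : (0 <= \sum_(t <oo) \sum_(i <oo) (\1_(late_box h j q t i) w : R)%:E)%E.
  by apply: nneseries_ge0.
have F1 j : (0 <= \sum_(q <oo) \sum_(t <oo) \sum_(i <oo)
    (\1_(late_box h j q t i) w : R)%:E)%E.
  by apply: nneseries_ge0.
have F0 : (0 <= F)%E by apply: sume_ge0.
have E0 : (0 <= E)%E by apply: nneseries_ge0.
have DS : (nD : 'I_n.+2) != nS by rewrite -val_eqE nDE nSE.
have relS (v : 'I_n.+2) : is_relay v -> v != nS by rewrite is_relayE => /andP[].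
have arrD : arrival g nS nD 0 = G nS nD 0%N w by rewrite arrivalS.
rewrite /delivery_FM; set tau := \big[Num.min/_]_(v < _ | _) _.
have tau_le v : is_relay v -> tau <= G nS v 0%N w.
  by move=> vr; rewrite -[leRHS]/(g nS v 0%N) -arrivalS ?relS//; exact: bigmin_le_cond.
have tauE x : x <= tau -> (x%:E <= E)%E.
  move=> xt; apply: nneseries_count_ge => // t tx.
  rewrite lee_fin indicE mem_set// => x0 /=.
  rewrite !inE => /orP[] /eqP -> /=; split=> //; apply: lt_le_trans tx _;
    apply: le_trans xt _; exact: tau_le.
have EF0 : (0 <= (2 * h)%:E + E + F)%E.
  by rewrite !adde_ge0// lee_fin mulr_ge0// ltW.
have E2 : (2%:E * E = E + E)%E by rewrite -[2%:E]/(1%:E + 1%:E)%E ge0_muleDl// !mul1e.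
case: ifP => [Dfirst|Dlate].
  apply: (le_trans (tauE _ Dfirst)); rewrite E2.
  have -> : ((2 * h)%:E + (E + E) + F = E + ((2 * h)%:E + E + F))%E.
    by rewrite addeCA !addeA.
  exact: leeDl.
have [j jr tj] : exists2 j, is_relay j & arrival g nS j 0 = tau.
  case: (@bigmin_mem R _ is_relay (fun v => arrival g nS v 0) (arrival g nS nD 0)) => //.
  by rewrite -/tau => et; rewrite et lexx in Dlate.
case: pickP => [{tj jr}j /andP[jr /eqP tj]|nopick]; last first.
  by have := nopick j; rewrite jr tj eqxx.
set y := Order.min _ _.
have tau0 : 0 < tau.
  by rewrite -tj arrivalS ?relS//; apply: Gp; move: (relS _ jr); rewrite -val_eqE nSE /= lt0n.
have [q /andP[q1 q2]] := min_multiple_lt h0 tau0.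
set a := q.+1%:R * h in q2.
have a_le : a <= tau + h by rewrite /a -natr1 mulrDl mul1r; lra.
have yD : (y <= (G nS nD 0%N w)%:E)%E.
  rewrite /y ge_min; apply/orP; left; apply: ereal_inf_lbound; exists 0%N.
    by rewrite /= ltNge Dlate.
  by rewrite arrD.
have Dj : ((nD : 'I_n.+2) < j)%N.
  by change (is_true (val (nD : 'I_n.+2) < j)%N); rewrite nDE.
have arrj i : arrival g j nD i = \sum_(l < i.+1) G nD j l w.
  by rewrite /arrival; apply: eq_bigr => l _; rewrite /gap ltnNge ltnW.
have yj i : tau < \sum_(l < i.+1) G nD j l w -> (y <= (\sum_(l < i.+1) G nD j l w)%:E)%E.
  move=> ti; rewrite /y ge_min; apply/orP; right; apply: ereal_inf_lbound.
  by exists i; rewrite /= arrj.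
have inbox t : ((2 * a + t%:R)%:E < y)%E -> exists i, w \in late_box h j q t i.
  move=> ty.
  have ex : exists i, a < \sum_(l < i.+1) G nD j l w.
    have [l al] := Gu j q jr; exists l; apply: lt_le_trans al _.
    rewrite (bigD1 ord_max)//= lerDl; apply: sumr_ge0 => k _; exact/ltW/Gp.
  case: (ex_minnP ex) => i ai imin; exists i.
  have yi := lt_le_trans ty (yj _ (le_lt_trans q2 ai)).
  rewrite lte_fin in yi; have a0 : 0 <= a by rewrite mulr_ge0// ltW.
  have small l : (l < i)%N -> \sum_(k < l.+1) G nD j k w <= a.
    by move=> li; rewrite leNgt; apply/negP => /imin; rewrite leqNgt li.
  (* The meeting of [j] and [D] with index [i - 1] is not later than [a] and the next one is later
     than [2 * a + t]. For [i = 0] the gap starts at time 0, which is even better. *)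
  have Gi : a + t%:R < G nD j i w.
    move: yi; rewrite big_ord_recr/=; case: i {ai imin} small => [_|i small].
      by rewrite big_ord0 add0r; lra.
    by have := small i (ltnSn i); lra.
  rewrite mem_set// => x xL.
  have : x \in [seq (nS, v, 0%N) | v <- nodes] ++ [seq (nD, j, l) | l <- iota 0 i.+1] := xL.
  rewrite mem_cat => /orP[] /mapP.
    move=> [v]; rewrite mem_filter => /andP[vS _] -> /=; rewrite ?eqxx.
    split.
      case: eqP => [->|/eqP vD].
        have := lt_le_trans ty yD; rewrite lte_fin; have := a0; lra.
      by apply: lt_le_trans q1 _; apply: tau_le; rewrite is_relayE vS.
    have [->|_] := eqVneq v j; last by [].
    rewrite /=; apply/negP; rewrite -leNgt.
    by rewrite -[leLHS]/(g nS j 0%N) -arrivalS ?relS// tj.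
  move=> [l]; rewrite mem_iota add0n ltnS => li -> /=.
  rewrite (negbTE DS); split; first by case: eqP => [->//|_]; exact: Gp.
  have [li'|_] := boolP (l < i)%N; last by [].
  rewrite /=; apply/negP; rewrite -leNgt; apply: le_trans (small _ li').
  rewrite (bigD1 ord_max)//= lerDl; apply: sumr_ge0 => k _; exact/ltW/Gp.
apply: (@le_trans _ _ ((2 * a)%:E + F)%E).
  case: (leP y (2 * a)%:E) => ya; first by apply: le_trans ya _; exact: leeDl.
  have yf : y \is a fin_num.
    by rewrite fin_numE; apply/andP; split; apply/eqP => yy; move: ya yD; rewrite yy.
  have -> : y = ((2 * a)%:E + (fine y - 2 * a)%:E)%E.
    by rewrite -EFinD addrC subrK fineK.
  apply: leeD2l; rewrite /F (bigD1 j)//=.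
  apply: (@le_trans _ _ (\sum_(t <oo) \sum_(i <oo) (\1_(late_box h j q t i) w)%:E)%E).
    apply: nneseries_count_ge => // t ty.
    have [|i wi] := inbox t.
      by rewrite -(fineK yf) lte_fin; lra.
    apply: (@le_trans _ _ (\sum_(0 <= k < i.+1) (\1_(late_box h j q t k) w)%:E)%E).
      rewrite big_nat_recr//= [in X in (_ <= X)%E]indicE wi leeDr//.
      by apply: sume_ge0.
    exact: nneseries_lim_ge.
  apply: (@le_trans _ _ (\sum_(0 <= k < q.+1) \sum_(t <oo) \sum_(i <oo)
      (\1_(late_box h j k t i) w)%:E)%E).
    by rewrite big_nat_recr//= leeDr// sume_ge0.
  apply: (@le_trans _ _ (\sum_(q <oo) \sum_(t <oo) \sum_(i <oo)
      (\1_(late_box h j q t i) w)%:E)%E); first exact: nneseries_lim_ge.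
  by apply: leeDl; apply: sume_ge0.
apply: leeD2r.
apply: (@le_trans _ _ ((2 * h)%:E + (tau + tau)%:E)%E).
  by rewrite -EFinD lee_fin; lra.
by rewrite E2; apply: leeD2l; rewrite EFinD; apply: leeD; exact: tauE.
Qed.

(** * Summation of the box probabilities *)

Definition early_bound (w : T) : R :=
  (1 - expR (- (rate nS relayA w + rate nS relayB w)))^-1.

(** A closed form for the sum of the conditional probabilities of the late boxes: the last factor
    comes from the sum over [t], the second from the sum over the cells [q], and the first is the
    probability that [S] meets [j] within a given step of length [h]. The sum over [i] leaves no
    trace. *)
Definition late_bound (h : R) (j : 'I_n.+2) (w : T) : R :=
  (1 - expR (- (rate nS j w * h))) *
  (1 - expR (- ((rate nS j w + relay_rate j w) * h)))^-1 *
  (1 - expR (- (rate nS nD w + rate nD j w)))^-1.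

Lemma relay_rate_ge0 j w : 0 <= relay_rate j w.
Proof. by apply: sumr_ge0 => v _; exact/ltW/rate_gt0. Qed.

Let expR_01 (x : R) : 0 < x -> 0 <= expR (- x) < 1.
Proof. by move=> x0; rewrite expR_ge0/= -expR0 ltr_expR oppr_lt0. Qed.

Lemma early_box_series : (\sum_(t <oo) P (early_box t) <= \int[P]_w (early_bound w)%:E)%E.
Proof.
under eq_eseriesr do rewrite early_box_law.
apply: nneseries_integral_le => [t|t w|N w].
- apply: measurable_funX; apply: measurableT_comp => //; apply: measurableT_comp => //.
  by apply: measurable_funD; exact: measurable_rate.
- by rewrite exprn_ge0// expR_ge0.
- by apply: sum_geometric_le; apply: expR_01; apply: addr_gt0; exact: rate_gt0.
Qed.

Lemma late_box_series (h : R) (j : 'I_n.+2) : 0 < h -> is_relay j ->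
  (\sum_(q <oo) \sum_(t <oo) \sum_(i <oo) P (late_box h j q t i) <=
   \int[P]_w (late_bound h j w)%:E)%E.
Proof.
move=> h0 jr.
pose la w := rate nS j w; pose mu w := rate nS nD w + rate nD j w.
pose La w := relay_rate j w.
have la0 w : 0 < la w by exact: rate_gt0.
have mu0 w : 0 < mu w by apply: addr_gt0; exact: rate_gt0.
have La0 w : 0 <= La w by exact: relay_rate_ge0.
have qh k : 0 <= k%:R * h by rewrite mulr_ge0// ltW.
have mla : measurable_fun setT la by exact: measurable_rate.
have mmu : measurable_fun setT mu by apply: measurable_funD; exact: measurable_rate.
have mLa : measurable_fun setT La.
  rewrite /La /relay_rate; under eq_fun do rewrite -big_filter.
  by apply: measurable_sum => v; exact: measurable_rate.
have mexp (f : T -> R) : measurable_fun setT f -> measurable_fun setT (fun w => expR (- f w)).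
  by move=> mf; apply: measurableT_comp => //; exact: measurableT_comp.
pose z w := expR (- ((la w + La w) * h)).
have mz : measurable_fun setT z.
  by apply: mexp; apply: measurable_funM => //; exact: measurable_funD.
have z01 w : 0 <= z w < 1.
  by apply: expR_01; rewrite mulr_gt0// ltr_pwDl.
have e01 w : 0 <= expR (- mu w) < 1 by exact: expR_01.
pose c w := 1 - expR (- (la w * h)).
have c0 w : 0 <= c w by apply: onem_expR_ge0; rewrite mulr_ge0// ltW.
have mc : measurable_fun setT c.
  by apply: measurable_funB => //; apply: mexp; exact: measurable_funM.
(* Meeting [j] in cell [q] and no other relay before that cell has a probability geometric in
   [q]. *)
have cE w q : (expR (- (la w * (q%:R * h))) - expR (- (la w * (q.+1%:R * h)))) *
     expR (- (La w * (q%:R * h))) = c w * z w ^+ q.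
  rewrite /z -expR_mul_nat /c mulrBl mulrBl mul1r -!expRD.
  by congr (expR _ - expR _); rewrite -?natr1; ring.
pose p1 q t w := (c w * z w ^+ q) * expR (- mu w) ^+ t.
pose p2 q w := (c w * z w ^+ q) * (1 - expR (- mu w))^-1.
have nu0 w : 0 <= (1 - expR (- mu w))^-1.
  by rewrite invr_ge0 onem_expR_ge0// ltW.
have cz0 q w : 0 <= c w * z w ^+ q.
  by rewrite mulr_ge0// exprn_ge0//; case/andP: (z01 w).
have mcz q : measurable_fun setT (fun w => c w * z w ^+ q).
  by apply: measurable_funM => //; exact: measurable_funX.
apply: (@le_trans _ _ (\sum_(q <oo) \int[P]_w (p2 q w)%:E)%E); last first.
  apply: nneseries_integral_le => [q|q w|N w].
  - apply: measurable_funM => //; apply: measurable_fun_inv.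
      by apply: measurable_funB => //; exact: mexp.
    by move=> w; apply: onem_expR_ge0; exact: ltW.
  - exact: mulr_ge0.
  - rewrite -mulr_suml -mulr_sumr /late_bound -/(la w) -/(mu w) -/(La w) -/(z w) -/(c w).
    by apply: ler_wpM2r => //; apply: ler_wpM2l => //; exact: sum_geometric_le.
have P0 q t i : (0 <= P (late_box h j q t i))%E by [].
apply: lee_nneseries => [q _ _|q _]; first by apply: nneseries_ge0 => // t _ _; exact: nneseries_ge0.
apply: (@le_trans _ _ (\sum_(t <oo) \int[P]_w (p1 q t w)%:E)%E); last first.
  apply: nneseries_integral_le => [t|t w|N w].
  - by apply: measurable_funM => //; apply: measurable_funX; exact: mexp.
  - by rewrite mulr_ge0// exprn_ge0// expR_ge0.
  - by rewrite -mulr_sumr; apply: ler_wpM2l => //; exact: sum_geometric_le.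
apply: lee_nneseries => [t _ _|t _]; first exact: nneseries_ge0.
under eq_eseriesr do rewrite (late_box_law _ _ _ (ltW h0) jr).
have mr : measurable_fun setT (rate nD j) by exact: measurable_rate.
have md : measurable_fun setT (rate nS nD) by exact: measurable_rate.
apply: nneseries_integral_le => [i|i w|N w].
- apply: measurable_funM.
    apply: measurable_funM; first by apply: mexp; exact: measurable_funM.
    by under eq_fun do rewrite -/(la _) -/(La _) cE; exact: mcz.
  apply: measurable_funM; last by apply: mexp; exact: measurable_funM.
  apply: measurable_funX; apply: measurable_funB => //; apply: mexp.
  exact: measurable_funM.
- rewrite -/(la w) -/(La w) cE !mulr_ge0 ?expR_ge0 ?cz0//; apply: exprn_ge0.
    by case/andP: (z01 w).
  by rewrite onem_expR_ge0// mulr_ge0// ltW// rate_gt0.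
- under eq_bigr do rewrite -/(la w) -/(La w) cE.
  rewrite -mulr_sumr -mulr_suml /p1.
  set r := rate nD j w; set a := q.+1%:R * h; set S := \sum_(i < N) _.
  (* The sum over [i] is at most [e^(ra)], which cancels the [e^(-ra)] contained in the tail
     [e^(-r(a + t))], whatever the cell. *)
  have S1 : S <= (expR (- (r * a)))^-1.
    rewrite /S; set x := 1 - expR (- (r * a)).
    have -> : expR (- (r * a)) = 1 - x by rewrite /x; ring.
    apply: sum_geometric_le; rewrite onem_expR_ge0/=; last first.
      by rewrite mulr_ge0 ?qh// ltW// rate_gt0.
    by rewrite ltrBlDr ltrDl expR_gt0.
  apply: (@le_trans _ _ (expR (- (rate nS nD w * t%:R)) * (c w * z w ^+ q) *
     ((expR (- (r * a)))^-1 * expR (- (r * (a + t%:R)))))).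
    apply: ler_wpM2l; first by rewrite mulr_ge0// expR_ge0.
    by apply: ler_wpM2r => //; rewrite expR_ge0.
  rewrite -expRN -expRD -expR_mul_nat mulrC mulrA -expRD mulrC le_eqVlt; apply/orP; left.
  by apply/eqP; congr (_ * expR _); rewrite /mu -/r; ring.
Qed.

Lemma delivery_FM_integral_le (h : R) : 0 < h ->
  (\int[P]_w delivery_FM (fun a b l => G a b l w) <=
   (2 * h)%:E + 2%:E * \int[P]_w (early_bound w)%:E +
   \sum_(j < n.+2 | is_relay j) \int[P]_w (late_bound h j w)%:E)%E.
Proof.
move=> h0.
(* The exceptional sets, a nonpositive gap or positive gaps all bounded by a grid point, are
   enumerated by [pickle] codes to form countable unions. *)
pose N1 k : set T := if @unpickle ('I_n.+2 * 'I_n.+2 * nat)%type k is Some (a, b, l)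
  then (if (a < b)%N then [set w | G a b l w <= 0] else set0) else set0.
pose N2 k : set T := if @unpickle ('I_n.+2 * nat)%type k is Some (j, q)
  then (if is_relay j then [set w | forall l, 0 < G nD j l w <= q.+1%:R * h] else set0)
  else set0.
have nD1 (j : 'I_n.+2) : is_relay j -> ((nD : 'I_n.+2) < j)%N.
  by move=> jr; change (is_true (val (nD : 'I_n.+2) < j)%N); rewrite nDE.
(* [delivery_FM] is not known to be measurable: it is dominated everywhere by a
   measurable function, which is set to +oo on a null set through [Z] below. *)
have [B [mB PB0 NB]] : P.-negligible (\bigcup_k N1 k `|` \bigcup_k N2 k).
  apply: negligibleU; apply: negligible_bigcup => k.
    rewrite /N1; case: unpickle => [[[a b] l]|]; last exact: negligible_set0.
    by case: ifP => ab; [exact: gap_le0_negligible|exact: negligible_set0].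
  rewrite /N2; case: unpickle => [[j q]|]; last exact: negligible_set0.
  case: ifP => jr; last exact: negligible_set0.
  by apply: gap_bounded_negligible; [exact: nD1|rewrite mulr_ge0// ltW].
pose E w := (\sum_(t <oo) (\1_(early_box t) w : R)%:E)%E.
pose F j w := (\sum_(q <oo) \sum_(t <oo) \sum_(i <oo) (\1_(late_box h j q t i) w : R)%:E)%E.
pose Z w := (\sum_(k <oo) (\1_B w : R)%:E)%E.
have ind0 (A : set T) w : (0 <= (\1_A w : R)%:E)%E by rewrite lee_fin.
have mind (A : set T) : measurable A -> measurable_fun setT (fun w => (\1_A w : R)%:E).
  by move=> mA; apply/measurable_EFinP; exact: measurable_indic.
have Z0 w : (0 <= Z w)%E by exact: nneseries_ge0.
have E0 w : (0 <= E w)%E by exact: nneseries_ge0.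
have F3 j q t w : (0 <= \sum_(i <oo) (\1_(late_box h j q t i) w : R)%:E)%E.
  exact: nneseries_ge0.
have F2 j q w : (0 <= \sum_(t <oo) \sum_(i <oo) (\1_(late_box h j q t i) w : R)%:E)%E.
  exact: nneseries_ge0.
have F0 j w : (0 <= F j w)%E by exact: nneseries_ge0.
have mbox L lo hi bd : measurable (gap_box L lo hi bd) by exact: measurable_gap_box.
have mE : measurable_fun setT E by apply: ge0_emeasurable_sum => // t _; apply: mind; exact: mbox.
have mZ : measurable_fun setT Z by apply: ge0_emeasurable_sum => // t _; apply: mind; exact: mB.
have mF3 j q t : measurable_fun setT
    (fun w => \sum_(i <oo) (\1_(late_box h j q t i) w : R)%:E)%E.
  by apply: ge0_emeasurable_sum => // i _; apply: mind; exact: mbox.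
have mF2 j q : measurable_fun setT
    (fun w => \sum_(t <oo) \sum_(i <oo) (\1_(late_box h j q t i) w : R)%:E)%E.
  by apply: ge0_emeasurable_sum => // t _.
have mF j : measurable_fun setT (F j) by apply: ge0_emeasurable_sum => // q _.
have iind (A : set T) : measurable A -> (\int[P]_w (\1_A w : R)%:E = P A)%E.
  by move=> mA; rewrite integral_indic// setIT.
have iE : (\int[P]_w E w = \sum_(t <oo) P (early_box t))%E.
  rewrite integral_nneseries//; last by move=> t; apply: mind; exact: mbox.
  by apply: eq_eseriesr => t _; apply: iind; exact: mbox.
have iZ : (\int[P]_w Z w = 0)%E.
  rewrite integral_nneseries//; last by move=> t; apply: mind; exact: mB.
  rewrite (eq_eseriesr (g := fun=> 0%E)); first by rewrite eseries0.
  by move=> t _; rewrite iind.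
have iF j : (\int[P]_w F j w = \sum_(q <oo) \sum_(t <oo) \sum_(i <oo) P (late_box h j q t i))%E.
  rewrite integral_nneseries//; apply: eq_eseriesr => q _.
  rewrite integral_nneseries//; apply: eq_eseriesr => t _.
  rewrite integral_nneseries//; last by move=> i; apply: mind; exact: mbox.
  by apply: eq_eseriesr => i _; apply: iind; exact: mbox.
pose H w := ((2 * h)%:E + 2%:E * E w + \sum_(j < n.+2 | is_relay j) F j w + Z w)%E.
have h20 : (0 <= (2 * h)%:E)%E by rewrite lee_fin mulr_ge0// ltW.
have SF0 w : (0 <= \sum_(j < n.+2 | is_relay j) F j w)%E by exact: sume_ge0.
have EE0 w : (0 <= 2%:E * E w)%E by exact: mule_ge0.
have H0 w : (0 <= H w)%E by rewrite !adde_ge0.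
apply: (@le_trans _ _ (\int[P]_w H w)%E).
  apply: le_integral_nonmeasurable => // w.
  have [wB|wB] := pselect (B w).
    suff -> : H w = +oo%E by exact: leey.
    have ZE : Z w = +oo%E.
      apply/eqyP => r _; apply: nneseries_count_ge => // t _.
      by rewrite lee_fin indicE mem_set.
    have H1 : (0 <= (2 * h)%:E + 2%:E * E w + \sum_(j < n.+2 | is_relay j) F j w)%E.
      by rewrite !adde_ge0.
    by rewrite /H ZE addey//; apply/eqP => e; move: H1; rewrite e.
  apply: (@le_trans _ _ ((2 * h)%:E + 2%:E * E w + \sum_(j < n.+2 | is_relay j) F j w)%E);
    last exact: leeDl.
  apply: delivery_FM_le => //.
    move=> a b l ab; rewrite ltNge; apply/negP => Gab; apply: wB; apply: NB; left.
    by exists (pickle (a, b, l)) => //; rewrite /N1 pickleK ab.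
  move=> j q jr; apply: contrapT => nex; apply: wB; apply: NB.
  have [[l Gl]|Gp] := pselect (exists l, G nD j l w <= 0).
    left; exists (pickle (nD : 'I_n.+2, j, l)) => //.
    by rewrite /N1 pickleK nD1.
  right; exists (pickle (j, q)) => //; rewrite /N2 pickleK jr => l.
  apply/andP; split.
    by rewrite ltNge; apply/negP => Gl; apply: Gp; exists l.
  by rewrite leNgt; apply/negP => Gl; apply: nex; exists l.
have mSF : measurable_fun setT (fun w => \sum_(j < n.+2 | is_relay j) F j w)%E.
  by under eq_fun do rewrite -big_filter; exact: emeasurable_sum.
have mEE : measurable_fun setT (fun w => 2%:E * E w)%E.
  by apply: emeasurable_funM.
rewrite /H ge0_integralD//; last 2 first.
- by move=> w _; rewrite !adde_ge0.
- by apply: emeasurable_funD => //; exact: emeasurable_funD.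
rewrite iZ adde0 ge0_integralD//; last 2 first.
- by move=> w _; rewrite adde_ge0.
- exact: emeasurable_funD.
apply: leeD.
  rewrite ge0_integralD// integral_cst_probability; apply: leeD2l.
  rewrite ge0_integralZl_EFin//; apply: lee_wpmul2l; first by rewrite lee_fin.
  by rewrite iE; exact: early_box_series.
under eq_integral do rewrite -big_filter.
rewrite ge0_integral_sum// big_filter; apply: lee_sum => j jr.
by rewrite iF; exact: late_box_series.
Qed.

(** * Expectations of the inverse rates *)

Hypothesis n3 : (3 <= n)%N.
Hypothesis delta_half : delta <= lam / 2.
Hypothesis Xlaw : forall (b : 'I_n.+2 -> R) (a : 'I_n.+2 -> nat -> R),
  P (\bigcap_(v in [set v : 'I_n.+2 | v != nS])
       [set w | angleS (X v w) <= b v /\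
                forall i, (i < m.-1)%N -> dirS (X v w) i <= a v i])
  = (\prod_(v < n.+2 | v != nS) (unif_cdf (b v) * sph_cdf m.-1 (a v)))%:E.

Let lam0 : 0 < lam. Proof. by have := delta0; have := delta_lam; lra. Qed.
(** The constant of [inv_le_weights] for [k = lam / 2] and [kap = cos 1 / 2]; it involves neither
    [n] nor [delta]. *)
Let weightC : R := 1 + (2 * (lam / 2) * (cos 1 / 2))^-1.
Let weightC_ge1 : 1 <= weightC.
Proof.
rewrite /weightC lerDl invr_ge0; have := cos1_gt0 R; have := lam0 => h1 h2.
by apply: mulr_ge0; lra.
Qed.

(** Uses [pi / 2 >= 1] and [lam - delta >= lam / 2], so that the bound is uniform in [delta]. *)
Lemma rate_S_ge v w : lam / 2 * X v w 0%N <= rate nS v w.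
Proof.
have m0 : (0 < m)%N by exact: ltnW.
rewrite /rate /rate_ib XS dotm_e1//.
have /andP[x0 _] := orthant_coord_le1 m2 (Xo v w).
apply: (@le_trans _ _ (pi / 2 * (lam - delta) * X v w 0%N)).
  apply: ler_wpM2r => //.
  have -> : lam / 2 = 1 * (lam / 2) by ring.
  apply: ler_pM; rewrite ?ler01//; have := lam0; have := delta_half; last by lra.
    by lra.
  by move=> _ _; exact: pihalf_ge1.
by rewrite lerDl ltW.
Qed.

(** Only the product of the coordinates 1 is kept from the inner product, whose terms are all
    nonnegative. *)
Lemma rate_D_ge j w : lam / 2 * (X nD w 1%N * X j w 1%N) <= rate nD j w.
Proof.
have [xD _] := Xo nD w; have [xj _] := Xo j w.
apply: (@le_trans _ _ (pi / 2 * (lam - delta) * dotm m (X nD w) (X j w))); last first.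
  by rewrite /rate /rate_ib lerDl ltW.
apply: ler_pM; rewrite ?mulr_ge0 ?xD ?xj//; last exact: dotm_ge2.
  by have := lam0; lra.
have -> : lam / 2 = 1 * (lam / 2) by ring.
apply: ler_pM; rewrite ?ler01//; have := lam0; have := delta_half; last by lra.
  by lra.
by move=> _ _; exact: pihalf_ge1.
Qed.

Let W (K : nat) (v : 'I_n.+2) (w : T) : R := profile_weight X K v w.

(** Here [y] is the sum of the two cosines, and [4 * cos a * cos b <= y ^+ 2]. Multiplying the
    cosines by the coordinates 1, which are at most 1, only decreases the left side and allows the
    same weights as for the rates with [D]. *)
Lemma inv_rate_SS_le K a b w : (0 < K)%N -> 1 <= delta * 2 ^+ K ->
  (rate nS a w + rate nS b w)^-1 <= weightC * (W K a w * W K b w).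
Proof.
move=> K0 dK.
have /andP[a0 _] := orthant_coord_le1 m2 (Xo a w).
have /andP[b0 _] := orthant_coord_le1 m2 (Xo b w).
have a1 : 0 <= X a w 1%N <= 1.
  have [xa _] := Xo a w; rewrite xa//= -(@expr_le1 _ 2) ?xa//.
  have m1 : (0 < m.-1)%N by rewrite ltn_predRL.
  by apply: le_trans (orthant_coordS_sqr (Xo a w) m1) _; rewrite lerBlDr lerDl sqr_ge0.
have b1 : 0 <= X b w 1%N <= 1.
  have [xb _] := Xo b w; rewrite xb//= -(@expr_le1 _ 2) ?xb//.
  have m1 : (0 < m.-1)%N by rewrite ltn_predRL.
  by apply: le_trans (orthant_coordS_sqr (Xo b w) m1) _; rewrite lerBlDr lerDl sqr_ge0.
have ra := rate_S_ge a w; have rb := rate_S_ge b w.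
apply: (@inv_le_weights R K (cos 1 / 2) (lam / 2) delta _ (X a w 0%N + X b w 0%N)
   _ _ (X a w 0%N * X a w 1%N) (X b w 0%N * X b w 1%N)) => //.
- by have := cos1_gt0 R; lra.
- by have := lam0; lra.
- by apply: ler_wpDr (rate_ge nS a w); exact/ltW/rate_gt0.
- by rewrite mulrDr; exact: lerD.
- exact: addr_ge0.
- apply: (@le_trans _ _ (4 * (X a w 0%N * X b w 0%N))).
    apply: ler_wpM2l => //; apply: ler_pM; rewrite ?mulr_ge0//; try by case/andP: a1; case/andP: b1.
      by rewrite ler_piMr//; case/andP: a1.
    by rewrite ler_piMr//; case/andP: b1.
  by have := sqr_ge0 (X a w 0%N - X b w 0%N); rewrite sqrrB sqrrD; lra.
- exact: (profile_weight_cases m2 K0 (Xo a w)).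
- exact: (profile_weight_cases m2 K0 (Xo b w)).
Qed.

(** Here [y] is [cos D + u_D * u_j], with [u] the coordinate 1; the product of its two terms
    dominates [(cos D * u_D) * (cos j * u_j)]. *)
Lemma inv_rate_SD_le K j w : (0 < K)%N -> 1 <= delta * 2 ^+ K ->
  (rate nS nD w + rate nD j w)^-1 <= weightC * (W K nD w * W K j w).
Proof.
move=> K0 dK.
have /andP[D0 _] := orthant_coord_le1 m2 (Xo nD w).
have /andP[j0 j0'] := orthant_coord_le1 m2 (Xo j w).
have D1 : 0 <= X nD w 1%N by have [xD _] := Xo nD w; exact: xD.
have j1 : 0 <= X j w 1%N by have [xj _] := Xo j w; exact: xj.
have rD := rate_S_ge nD w; have rj := rate_D_ge j w.
apply: (@inv_le_weights R K (cos 1 / 2) (lam / 2) delta _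
   (X nD w 0%N + X nD w 1%N * X j w 1%N)
   _ _ (X nD w 0%N * X nD w 1%N) (X j w 0%N * X j w 1%N)) => //.
- by have := cos1_gt0 R; lra.
- by have := lam0; lra.
- by apply: ler_wpDr (rate_ge nS nD w); exact/ltW/rate_gt0.
- by rewrite mulrDr; exact: lerD.
- by rewrite addr_ge0// mulr_ge0.
- apply: (@le_trans _ _ (4 * (X nD w 0%N * (X nD w 1%N * X j w 1%N)))).
    apply: ler_wpM2l => //; rewrite -mulrA; apply: ler_wpM2l => //.
    by apply: ler_wpM2l => //; rewrite ler_piMl.
  by have := sqr_ge0 (X nD w 0%N - X nD w 1%N * X j w 1%N); rewrite sqrrB sqrrD; lra.
- exact: (profile_weight_cases m2 K0 (Xo nD w)).
- exact: (profile_weight_cases m2 K0 (Xo j w)).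
Qed.

Let others (j : 'I_n.+2) : pred 'I_n.+2 := fun v => is_relay v && (v != j).

Let card_relays : #|[pred v : 'I_n.+2 | is_relay v]| = n.
Proof.
have nDS : (nD : 'I_n.+2) != nS by rewrite -val_eqE nDE nSE.
have := card_ord n.+2; rewrite (cardD1 nS) (cardD1 nD) !inE nDS !add1n => -[h].
rewrite -[RHS]h; apply: eq_card => v.
by rewrite !inE is_relayE andbT andbC.
Qed.

Let card_others j : is_relay j -> #|others j| = n.-1.
Proof.
move=> jr; have := cardD1 j [pred v : 'I_n.+2 | is_relay v].
rewrite card_relays inE jr add1n => /(congr1 predn)/= ->.
by apply: eq_card => v; exact: andbC.
Qed.

Let others_relay j v : (v \in others j) = is_relay v && (v != j).
Proof. by []. Qed.

Let pairs (j : 'I_n.+2) : pred ('I_n.+2 * 'I_n.+2) :=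
  fun x => (x.1 \in others j) && ((x.2 \in others j) && (x.2 != x.1)).

Let card_pairs j : is_relay j -> #|pairs j| = (n.-1 * n.-2)%N.
Proof.
move=> jr; rewrite -sum1_card.
rewrite (eq_bigl (fun x => (x.1 \in others j) && ((x.2 \in others j) && (x.2 != x.1)))) //.
rewrite -(pair_big_dep (fun a => a \in others j)
  (fun a b => (b \in others j) && (b != a)) (fun _ _ => 1%N))/=.
rewrite (eq_bigr (fun=> n.-2)); first by rewrite sum_nat_const card_others.
move=> a aj; rewrite sum1_card.
have := cardD1 a (others j); rewrite aj card_others// add1n => h.
transitivity #|[predD1 others j & a]|; last by rewrite h.
by apply: eq_card => b; exact: andbC.
Qed.

(** The harmonic-arithmetic inequality is applied to the [(n - 1)(n - 2)] ordered pairs of distinct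
    relays other than [j], for which the sums of rates add up to at most [2 (n - 1)] times
    [relay_rate j w]. *)
Lemma inv_relay_rate_le j w : is_relay j ->
  (relay_rate j w)^-1 <= 2 / (n.-1%:R * n.-2%:R ^+ 2) *
    \sum_(x | pairs j x) (rate nS x.1 w + rate nS x.2 w)^-1.
Proof.
move=> jr; set S := \sum_(x | _) _.
have M0 : 0 < n.-1%:R :> R by rewrite ltr0n ltn_predRL ltnW.
have M1 : 0 < n.-2%:R :> R by rewrite ltr0n !ltn_predRL.
have r0 v : 0 < rate nS v w by exact: rate_gt0.
have := @harmonic_mean_le R _ (pairs j) (fun x => rate nS x.1 w + rate nS x.2 w)
  (fun x _ => addr_gt0 (r0 x.1) (r0 x.2)).
rewrite card_pairs// -/S.
have LE : relay_rate j w = \sum_(v in others j) rate nS v w.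
  by apply: eq_bigl => v; rewrite others_relay.
have L0 : 0 < relay_rate j w.
  rewrite LE; have /card_gt0P[v vj] : (0 < #|others j|)%N.
    by rewrite card_others// ltn_predRL ltnW.
  by rewrite (bigD1 v)//= ltr_wpDr//; apply: sumr_ge0 => u _; exact: ltW.
have S0 : 0 <= S.
  by apply: sumr_ge0 => x _; rewrite invr_ge0 ltW// addr_gt0.
have sum_le : \sum_(x | pairs j x) (rate nS x.1 w + rate nS x.2 w) <=
    2 * n.-1%:R * relay_rate j w.
  (* The diagonal pairs are added to obtain a full double sum. *)
  apply: (@le_trans _ _ (\sum_(a in others j) \sum_(b in others j)
     (rate nS a w + rate nS b w))).
    rewrite pair_big/= [leRHS](bigID (fun x => x.2 != x.1))/=.
    rewrite (eq_bigl (fun x => ((x.1 \in others j) && (x.2 \in others j)) && (x.2 != x.1)));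
      last by move=> x; rewrite /pairs andbA.
    by rewrite lerDl; apply: sumr_ge0 => x _; rewrite ltW// addr_gt0.
  under eq_bigr do rewrite big_split/= sumr_const card_others//.
  rewrite big_split/= sumr_const card_others// sumrMnl -LE -mulr_natl.
  by lra.
move=> h; have h2 := le_trans h (ler_wpM2r S0 sum_le).
rewrite -[leLHS]mul1r ler_pdivrMr//.
have c0 : 0 < 2 / (n.-1%:R * n.-2%:R ^+ 2) :> R.
  by rewrite divr_gt0// mulr_gt0// exprn_gt0.
have e0 : 0 < 2 * n.-1%:R * (n.-1%:R * n.-2%:R ^+ 2) / 2 :> R.
  by rewrite divr_gt0// !mulr_gt0// exprn_gt0.
rewrite -(ler_pM2l e0) mulr1.
have -> : 2 * n.-1%:R * (n.-1%:R * n.-2%:R ^+ 2) / 2 *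
    (2 / (n.-1%:R * n.-2%:R ^+ 2) * S * relay_rate j w) =
    2 * n.-1%:R * relay_rate j w * S by field; rewrite !gt_eqF.
apply: le_trans h2; rewrite natrM le_eqVlt; apply/orP; left.
by apply/eqP; field.
Qed.

Let vol : R := fine (volk m.-1 (cone_le m.-1 (fun _ => 1))).
Let mom : R := 32 / vol.
(** [2 * lam * (1 + 2 * lam)] bounds the probability of meeting [j] first relative to the inverse of
    [relay_rate]; [1 + weightC] and [weightC] come from the inverse rates with [D] and with pairs of
    relays. *)
Let lateC : R := 2 * lam * (1 + 2 * lam) * (1 + weightC) * weightC.

Let W_ge1 K v w : (0 < K)%N -> 1 <= W K v w.
Proof. by move=> K0; case: (profile_weight_cases m2 K0 (Xo v w)). Qed.

Lemma early_bound_integral_le K : (0 < K)%N -> 1 <= delta * 2 ^+ K ->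
  (\int[P]_w (early_bound w)%:E <= (1 + weightC * mom ^+ 2)%:E)%E.
Proof.
move=> K0 dK.
have AB : relayA != relayB.
  by apply/eqP => /(congr1 val); rewrite relayAE relayBE.
have SQ : nS \notin [set relayA; relayB]%SET.
  by rewrite !inE negb_or -!val_eqE nSE relayAE relayBE.
have [mW iW] := profile_weight_prod m2 mX Xo Xlaw K0 SQ.
rewrite cards2 AB/= in iW.
set F := fun w => \prod_(v in [set relayA; relayB]%SET) profile_weight X K v w.
have F0 w : 0 <= F w by apply: prodr_ge0 => v _; apply: le_trans (W_ge1 v w K0).
have c0 : 0 <= weightC by have := weightC_ge1; lra.
apply: (@le_trans _ _ (\int[P]_w (1 + weightC * F w)%:E)%E).
  apply: le_integral_nonmeasurable => w; rewrite lee_fin.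
    by rewrite addr_ge0// mulr_ge0.
  rewrite /early_bound; apply: le_trans (inv_onem_expR_le _) _.
    by apply: addr_gt0; exact: rate_gt0.
  rewrite lerD2l; apply: le_trans (inv_rate_SS_le _ _ _ K0 dK) _.
  by rewrite /F big_setU1 ?big_set1// inE.
under eq_integral do rewrite EFinD EFinM.
have mF : measurable_fun setT (fun w => (F w)%:E) by exact/measurable_EFinP.
rewrite ge0_integralD//; last 2 first.
- by move=> w _; rewrite mule_ge0// lee_fin.
- exact: measurable_funeM.
rewrite [(1 + weightC * _)%:E]EFinD; apply: leeD; first by rewrite integral_cst_probability.
rewrite ge0_integralZl_EFin//; last by move=> w _; rewrite lee_fin.
by rewrite [(weightC * _)%:E]EFinM; apply: lee_wpmul2l => //; rewrite lee_fin.
Qed.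

(** The bound is a combination of products of weights of four distinct nodes, a pair of relays, [D]
    and [j], each of expectation at most [mom ^+ 4]. Summing over the pairs leaves a factor
    [2 / (n - 2)], so that the [n] relays together contribute a bounded amount. *)
Lemma late_bound_integral_le K j : (0 < K)%N -> 1 <= delta * 2 ^+ K -> is_relay j ->
  (\int[P]_w (late_bound n%:R^-1 j w)%:E <= (lateC * (2 / n.-2%:R) * mom ^+ 4)%:E)%E.
Proof.
move=> K0 dK jr.
have N0 : 0 < n%:R :> R by rewrite ltr0n ltnW// ltnW.
have M0 : 0 < n.-1%:R :> R by rewrite ltr0n ltn_predRL ltnW.
have M1 : 0 < n.-2%:R :> R by rewrite ltr0n !ltn_predRL.
have l0 := lam0; have w1 := weightC_ge1.
pose quad (x : 'I_n.+2 * 'I_n.+2) : {set 'I_n.+2} := (x.1 |: (x.2 |: (nD |: [set j])))%SET.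
pose F x w := \prod_(v in quad x) profile_weight X K v w.
have /andP[jS jD] : (j != nS) && (j != nD) by rewrite -is_relayE.
have DS : (nD : 'I_n.+2) != nS by rewrite -val_eqE nDE nSE.
have othersP v : v \in others j -> [/\ v != nS, v != nD & v != j].
  by rewrite others_relay is_relayE => /andP[/andP[-> ->] ->].
have quadP x : pairs j x -> [/\ x.1 \notin (x.2 |: (nD |: [set j]))%SET,
    x.2 \notin (nD |: [set j])%SET, nD \notin [set j]%SET & nS \notin quad x].
  move=> /andP[/othersP[aS aD aj] /andP[/othersP[bS bD bj] ba]].
  rewrite !inE !negb_or aD aj bD bj [x.1 == x.2]eq_sym ba [nD == j]eq_sym jD/=; split => //.
  by rewrite ![nS == _]eq_sym aS bS DS jS.
have FE x w : pairs j x ->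
    F x w = W K x.1 w * W K x.2 w * (W K nD w * W K j w).
  by move=> /quadP[q1 q2 q3 _]; rewrite /F !big_setU1//= big_set1 !mulrA.
have F0 x w : 0 <= F x w by apply: prodr_ge0 => v _; apply: le_trans (W_ge1 v w K0).
have FP x : pairs j x -> measurable_fun setT (F x) /\
    (\int[P]_w (F x w)%:E <= (mom ^+ 4)%:E)%E.
  move=> px; have [q1 q2 q3 q4] := quadP x px.
  have [mF iF] := profile_weight_prod m2 mX Xo Xlaw K0 q4; split => //.
  apply: le_trans iF _.
  by rewrite /quad !cardsU1 cards1 q1 q2 q3.
pose c := lateC * (2 / (n.-1%:R * n.-2%:R ^+ 2)).
have lC0 : 0 <= lateC by rewrite /lateC !mulr_ge0//; lra.
have c0 : 0 <= c.
  by rewrite /c mulr_ge0// divr_ge0// mulr_ge0 ?ltW// exprn_gt0.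
pose s := [seq x <- index_enum ('I_n.+2 * 'I_n.+2)%type | pairs j x].
(* Set to 0 outside [pairs j], to be measurable for every index [x]. *)
pose F' x w := if pairs j x then F x w else 0.
have F'0 x w : 0 <= F' x w by rewrite /F'; case: ifP.
have mF' x : measurable_fun setT (fun w => (F' x w)%:E).
  apply/measurable_EFinP; rewrite /F'; case: (boolP (pairs j x)) => px.
    by case: (FP x px).
  exact: measurable_cst.
apply: (@le_trans _ _ (\int[P]_w (c%:E * \sum_(x <- s) (F' x w)%:E))%E); last first.
  rewrite ge0_integralZl_EFin//; last 2 first.
  - by move=> w _; apply: sume_ge0 => x _; rewrite lee_fin.
  - exact: emeasurable_sum.
  rewrite ge0_integral_sum//; last by move=> x w _; rewrite lee_fin.
  apply: (@le_trans _ _ (c%:E * \sum_(x <- s) (mom ^+ 4)%:E)%E).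
    apply: lee_wpmul2l; first by rewrite lee_fin.
    rewrite big_seq [leRHS]big_seq; apply: lee_sum => x.
    rewrite mem_filter => /andP[px _]; rewrite /F' px.
    by case: (FP x px).
  rewrite big_filter sumEFin sumr_const card_pairs// -EFinM lee_fin.
  rewrite -[(mom ^+ 4) *+ _]mulr_natl natrM /c le_eqVlt; apply/orP; left; apply/eqP.
  by field; rewrite !gt_eqF.
apply: le_integral_nonmeasurable => w.
  by rewrite mule_ge0 ?lee_fin//; apply: sume_ge0 => x _; rewrite lee_fin.
rewrite sumEFin -EFinM lee_fin.
set la := rate nS j w; set La := relay_rate j w; set mu := rate nS nD w + rate nD j w.
set h := n%:R^-1.
have h0 : 0 < h by rewrite invr_gt0.
have la0 : 0 < la by exact: rate_gt0.
have mu0 : 0 < mu by apply: addr_gt0; exact: rate_gt0.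
have LE : La = \sum_(v in others j) rate nS v w.
  by apply: eq_bigl => v; rewrite others_relay.
have La0 : 0 < La.
  rewrite LE; have /card_gt0P[v vj] : (0 < #|others j|)%N.
    by rewrite card_others// ltn_predRL ltnW.
  rewrite (bigD1 v)//= ltr_wpDr ?rate_gt0//.
  by apply: sumr_ge0 => u _; exact/ltW/rate_gt0.
(* This is the reason for the grid step [1/n]: as [La] is at most [2 * lam * n], the discretization
   error is of the order of [La^-1]. *)
have Lah : h <= 2 * lam / La.
  rewrite ler_pdivlMr// /h mulrC ler_pdivrMr//.
  apply: (@le_trans _ _ (\sum_(v in others j) (2 * lam))).
    by rewrite LE; apply: ler_sum => v _; exact: rate_le.
  rewrite sumr_const card_others// -[(2 * lam) *+ _]mulr_natr; apply: ler_wpM2l; first by lra.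
  by rewrite ler_nat leq_pred.
have muW : mu^-1 <= weightC * (W K nD w * W K j w) by exact: inv_rate_SD_le.
have WW1 : 1 <= W K nD w * W K j w.
  by rewrite -[leLHS]mulr1; apply: ler_pM => //; exact: W_ge1.
have laLa : 0 < la + La by exact: addr_gt0.
have lah0 : 0 < la * h by exact: mulr_gt0.
have lLh0 : 0 < (la + La) * h by exact: mulr_gt0.
have nu0 : 0 <= (1 - expR (- ((la + La) * h)))^-1.
  by rewrite invr_ge0; apply: onem_expR_ge0; exact: ltW.
have A1 : (1 - expR (- (la * h))) * (1 - expR (- ((la + La) * h)))^-1 <=
    2 * lam * (1 + 2 * lam) * La^-1.
  apply: (@le_trans _ _ (la * h * (1 + ((la + La) * h)^-1))).
    apply: ler_pM => //; first by apply: onem_expR_ge0; exact: ltW.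
      exact: onem_expR_le.
    exact: inv_onem_expR_le.
  have -> : la * h * (1 + ((la + La) * h)^-1) = la * (h + (la + La)^-1).
    by field; rewrite !gt_eqF.
  rewrite -[leRHS]mulrA; apply: ler_pM; [exact: ltW| |exact: rate_le|].
    by apply: addr_ge0; [exact: ltW|rewrite invr_ge0; exact: ltW].
  rewrite mulrDl mul1r addrC; apply: lerD => //.
  by rewrite lef_pV2 ?posrE// lerDr; exact: ltW.
have A2 : (1 - expR (- mu))^-1 <= (1 + weightC) * (W K nD w * W K j w).
  apply: le_trans (inv_onem_expR_le mu0) _.
  by rewrite mulrDl mul1r; apply: lerD.
have A3 : La^-1 <= 2 / (n.-1%:R * n.-2%:R ^+ 2) *
    (weightC * \sum_(x | pairs j x) W K x.1 w * W K x.2 w).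
  apply: le_trans (inv_relay_rate_le w jr) _; apply: ler_wpM2l.
    by rewrite divr_ge0// mulr_ge0 ?ltW// exprn_gt0.
  by rewrite mulr_sumr; apply: ler_sum => x _; exact: inv_rate_SS_le.
rewrite /late_bound -/la -/La -/mu -/h.
apply: (@le_trans _ _ (2 * lam * (1 + 2 * lam) * (2 / (n.-1%:R * n.-2%:R ^+ 2) *
    (weightC * \sum_(x | pairs j x) W K x.1 w * W K x.2 w)) *
    ((1 + weightC) * (W K nD w * W K j w)))).
  apply: ler_pM => //.
  - by apply: mulr_ge0 => //; apply: onem_expR_ge0; exact: ltW.
  - by rewrite invr_ge0; apply: onem_expR_ge0; exact: ltW.
  - apply: le_trans A1 _; apply: ler_wpM2l => //; by apply: mulr_ge0; lra.
rewrite le_eqVlt; apply/orP; left; apply/eqP.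
have -> : \sum_(x <- s) F' x w =
    (\sum_(x | pairs j x) W K x.1 w * W K x.2 w) * (W K nD w * W K j w).
  rewrite big_filter mulr_suml; apply: eq_bigr => x px.
  by rewrite /F' px FE.
rewrite /c /lateC; ring.
Qed.

Lemma delivery_FM_expectation_le :
  (\int[P]_w delivery_FM (fun a b l => G a b l w) <=
   (2 + 2 * (1 + weightC * mom ^+ 2) + 6 * (lateC * mom ^+ 4))%:E)%E.
Proof.
(* Any [K] with [2 ^+ K >= delta^-1] works, and the final bound does not depend on it. *)
pose K := (Num.bound delta^-1).+1.
have K0 : (0 < K)%N by [].
have d0 := delta0.
have dK : 1 <= delta * 2 ^+ K.
  rewrite -ler_pdivrMl// mulr1.
  apply: le_trans (ltW (archi_boundP _)) _; first by rewrite invr_ge0 ltW.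
  rewrite -natrX ler_nat; apply: leq_trans (ltnW (ltn_expl _ (ltnSn 1))) _.
  by rewrite leq_exp2l.
have N0 : 0 < n%:R :> R by rewrite ltr0n ltnW// ltnW.
have N1 : 1 <= n%:R :> R by rewrite ler1n ltnW// ltnW.
have M1 : 0 < n.-2%:R :> R by rewrite ltr0n !ltn_predRL.
have l0 := lam0; have w1 := weightC_ge1.
have lC0 : 0 <= lateC by rewrite /lateC !mulr_ge0//; lra.
have m4 : 0 <= mom ^+ 4 by rewrite -[4%N]/(2 * 2)%N exprM sqr_ge0.
have h0 : 0 < n%:R^-1 :> R by rewrite invr_gt0.
apply: le_trans (delivery_FM_integral_le h0) _.
apply: (@le_trans _ _ ((2 * n%:R^-1)%:E + 2%:E * (1 + weightC * mom ^+ 2)%:E +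
   \sum_(j < n.+2 | is_relay j) (lateC * (2 / n.-2%:R) * mom ^+ 4)%:E)%E).
  apply: leeD; last by apply: lee_sum => j jr; exact: (late_bound_integral_le K0 dK jr).
  apply: leeD2l; apply: lee_wpmul2l; first by rewrite lee_fin.
  exact: (early_bound_integral_le K0 dK).
rewrite sumEFin sumr_const card_relays -EFinM -!EFinD lee_fin.
apply: lerD.
  by rewrite lerD2r -[leRHS]mulr1; apply: ler_wpM2l => //; rewrite invf_le1.
rewrite -[leLHS]mulr_natl.
have -> : n%:R * (lateC * (2 / n.-2%:R) * mom ^+ 4) =
   (2 * n%:R / n.-2%:R) * (lateC * mom ^+ 4) by field; rewrite gt_eqF.
apply: ler_wpM2r; first exact: mulr_ge0.
rewrite ler_pdivrMr//.
(* For [n >= 3], [n <= 3 (n - 2)]: hence the constant 6. *)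
have -> : n%:R = n.-2%:R + 2 :> R.
  by rewrite -natrD -[n.-2]/(n.-1.-1) -!subn1 -subnDA subnK// ltnW.
have : 1 <= n.-2%:R :> R by rewrite ler1n !ltn_predRL.
by lra.
Qed.
End gap_boxes.

Theorem theorem6 (R : realType) (m : nat) (hm : (2 <= m)%N)
  (lam : R) (hlam : 0 < lam)
  (delta : nat -> R) (hdelta : forall n, 0 < delta n)
  (hdelta0 : delta n @[n --> \oo] --> (0 : R)) :
  exists (C : R) (N : nat), forall n : nat, (N <= n)%N ->
    forall (d : measure_display) (T : measurableType d) (P : probability T R)
      (X : 'I_n.+2 -> T -> nat -> R) (G : 'I_n.+2 -> 'I_n.+2 -> nat -> T -> R),
      FM_ib_model m lam (delta n) P X G ->
      (\int[P]_w delivery_FM (fun a b l => G a b l w) <= C%:E)%E.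
Proof.
have lam2 : 0 < lam / 2 by lra.
have [N _ hN] : \forall n \near \oo, delta n < lam / 2 by exact: cvgr_lt hdelta0 _ lam2.
(* The witness [C] is the bound of [delivery_FM_expectation_le], which involves only [lam] and [m].
   The 3 ensures that there are two relays besides any given one. *)
eexists; exists (maxn N 3) => n; rewrite geq_max => /andP[Nn n3] d T P X G.
move=> [mX [mG [XS [Xo [Xlaw Glaw]]]]].
have dl : delta n < lam / 2 by exact: hN.
have n2 : (1 < n)%N by exact: ltnW.
have dlam : delta n <= lam by lra.
apply: (@delivery_FM_expectation_le R m n lam (delta n) d T P X G) => //; last by exact: ltW.
(* The law of the gaps is the conditional one on the whole space, which belongs to the generated
   sigma-algebra as the complement of the empty set. *)
move=> L s uL aL s0.
have := Glaw setT L s _ uL aL s0; rewrite setTI; apply.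
by have [s0' sC _] := @smallest_sigma_algebra T setT
  [set A | exists v i (B : set R), measurable B /\ A = (fun w => X v w i) @^-1` B];
  have := sC _ s0'; rewrite setD0.
Qed.
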